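(* Let $a,b>2$ be integers and let $G_{a,b}$ be the grid graph with vertex set $\{1,\dots,a\}\times\{1,\dots,b\}$, two vertices being adjacent iff they differ by $1$ in exactly one coordinate and agree in the other. Then the radio number of $G_{a,b}$ is $$ \mathrm{rn}(G_{a,b}) = \begin{cases} \dfrac{a^2b+b^2a}{2}-ab-a-b+6, & \text{if } a,b \text{ are both even},\\[1em] \dfrac{a^2b+b^2a-a}{2}-ab-b+2, & \text{if } a \text{ is even and } b \text{ is odd},\\[1em] \dfrac{a^2b+b^2a-a-b}{2}-ab+2, & \text{if } a,b \text{ are both odd}. \end{cases} $$
   Context: For a simple connected graph $G$, let $d(u,v)$ be the graph (shortest-path) distance and $\mathrm{diam}(G)$ the diameter. A radio labeling of $G$ is a map $f:V(G)\to\mathbb{Z}_{\ge 0}$ such that $|f(u)-f(v)|\ge \mathrm{diam}(G)+1-d(u,v)$ for every pair of distinct vertices $u,v$. The span of $f$ is $\max_{u,v\in V(G)}|f(u)-f(v)|$, and the radio number $\mathrm{rn}(G)$ is the minimum span over all radio labelings of $G$. Note that $G_{a,b}$ is the Cartesian product of paths on $a$ and $b$ vertices, with diameter $a+b-2$. *)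

(* Defs.v *)
From mathcomp Require Import all_boot all_order all_algebra.
From mathcomp Require Import boolp.

Set Implicit Arguments.
Unset Strict Implicit.
Unset Printing Implicit Defensive.

Record connected_graph := ConnectedGraph {
  vertex :> finType;
  adj : rel vertex;
  adj_sym : symmetric adj;
  adj_irr : irreflexive adj;
  adj_conn : forall u v, connect adj u v
}.

Section RadioNumber.
Variable G : connected_graph.

Definition has_walk (u v : G) (k : nat) : bool :=
  [exists p : k.-tuple G, path (@adj G) u p && (last u p == v)].

Lemma has_walk_ex (u v : G) : exists k, has_walk u v k.
Proof.
have /connectP[p Hp ->] := adj_conn u v.
by exists (size p); apply/existsP; exists (in_tuple p); rewrite /= Hp eqxx.
Qed.

Definition dist (u v : G) : nat := ex_minn (has_walk_ex u v).

Definition diam : nat := \max_(u : G) \max_(v : G) dist u v.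

(* The outer bars are the absolute difference of two naturals. The subtraction
   on the left is in nat, but dist u v <= diam, so it never truncates. *)
Definition radio_labeling (f : G -> nat) : Prop :=
  forall u v : G, u != v -> diam + 1 - dist u v <= `|f u - f v|.

Definition span (f : G -> nat) : nat :=
  \max_(u : G) \max_(v : G) `|f u - f v|.

Definition radio_span (k : nat) : Prop :=
  exists2 f : G -> nat, radio_labeling f & span f = k.

Lemma radio_span_ex : exists k, `[< radio_span k >].
Proof.
pose f (u : G) : nat := diam.+1 * enum_rank u.
exists (span f); apply/asboolP; exists f => // u v neq_uv.
apply: leq_trans (leq_subr _ _) _; rewrite addn1 /f.
have : enum_rank u != enum_rank v :> nat.
  by rewrite (inj_eq val_inj) (inj_eq enum_rank_inj).
rewrite neq_ltn => /orP[lt_uv | lt_vu].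
- by rewrite distnC distnEl ?leq_mul2l ?(ltnW lt_uv) ?orbT //
    -mulnBr leq_pmulr // subn_gt0.
- by rewrite distnEl ?leq_mul2l ?(ltnW lt_vu) ?orbT //
    -mulnBr leq_pmulr // subn_gt0.
Qed.

Definition rn : nat := ex_minn radio_span_ex.

End RadioNumber.

Section Grid.
Variables a b : nat.

(* Coordinates are 0-based: ('I_a * 'I_b) stands for {1..a} x {1..b}. *)
Definition grid_adj (u v : 'I_a * 'I_b) : bool :=
  (`|u.1 - v.1| == 1) && (u.2 == v.2) || (u.1 == v.1) && (`|u.2 - v.2| == 1).

Lemma grid_adj_sym : symmetric grid_adj.
Proof.
move=> [x y] [x' y']; rewrite /grid_adj /=.
by rewrite (distnC x) (distnC y) (eq_sym x) (eq_sym y).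
Qed.

Lemma grid_adj_irr : irreflexive grid_adj.
Proof. by move=> [x y]; rewrite /grid_adj /= !distnn !andbF. Qed.

Lemma grid_connect_fst (x x' : 'I_a) (y : 'I_b) :
  connect grid_adj (x, y) (x', y).
Proof.
wlog le_xx' : x x' / x <= x'.
  move=> IH; case/orP: (leq_total x x') => [/IH // | /IH].
  by rewrite (sym_connect_sym grid_adj_sym).
case: x' le_xx' => m; elim: m => [|m IHm] lt_ma /=.
  by rewrite leqn0 => /eqP x0; rewrite (_ : x = Ordinal lt_ma) //; apply: val_inj.
rewrite leq_eqVlt => /orP[/eqP eq_x | lt_xm].
  by rewrite (_ : x = Ordinal lt_ma) //; apply: val_inj.
apply: connect_trans (IHm (ltnW lt_ma) lt_xm) (connect1 _).
by rewrite /grid_adj /= eqxx andbT distnS.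
Qed.

Lemma grid_connect_snd (x : 'I_a) (y y' : 'I_b) :
  connect grid_adj (x, y) (x, y').
Proof.
wlog le_yy' : y y' / y <= y'.
  move=> IH; case/orP: (leq_total y y') => [/IH // | /IH].
  by rewrite (sym_connect_sym grid_adj_sym).
case: y' le_yy' => m; elim: m => [|m IHm] lt_mb /=.
  by rewrite leqn0 => /eqP y0; rewrite (_ : y = Ordinal lt_mb) //; apply: val_inj.
rewrite leq_eqVlt => /orP[/eqP eq_y | lt_ym].
  by rewrite (_ : y = Ordinal lt_mb) //; apply: val_inj.
apply: connect_trans (IHm (ltnW lt_mb) lt_ym) (connect1 _).
by rewrite /grid_adj /= eqxx /= distnS orbT.
Qed.

Lemma grid_adj_conn (u v : 'I_a * 'I_b) : connect grid_adj u v.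
Proof.
case: u v => [x y] [x' y'].
exact: connect_trans (grid_connect_fst x x' y) (grid_connect_snd x' y y').
Qed.

Definition grid : connected_graph :=
  ConnectedGraph grid_adj_sym grid_adj_irr grid_adj_conn.

End Grid.

(* Main.v *)
Require Import Defs.
From mathcomp Require Import all_boot all_order all_algebra.
From mathcomp Require Import boolp zify lra.

(* Let D be the diameter, n = a b, and w(u) twice the distance from u to the centre of the
   grid, so that 2 d(u,v) <= w(u) + w(v), with equality when u and v lie on opposite sides of
   the centre in both coordinates. List the vertices by increasing label. Adding the
   constraints of consecutive vertices gives 2 span >= 2 (n-1)(D+1) - 2 (sum of w) + w(first)
   + w(last), and the end terms add up to at least 4 (both sides even) or 2 (otherwise). When
   both sides are even, a pair without loss joins opposite quadrants, so the list must lose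
   once to pass from one diagonal pair of quadrants to the other, and once more around a
   corner in each of the two.

   Conversely, the greedy labelling along a list of vertices is a radio labelling as soon as
   windows of three and four vertices behave. The lists used here are made of dominoes: two
   vertices differing by half of each side, whose weights therefore have a small sum; this
   settles the windows of four. When the sides are odd, the list is broken into segments so
   that each corner gets neighbours on both axes. *)

Set Implicit Arguments.
Unset Strict Implicit.
Unset Printing Implicit Defensive.

(** * Distance and diameter of the grid *)

Notation point := (nat * nat)%type.

(** The absolute difference, as a sum of two truncated differences of which at least one vanishes;
    this keeps every distance within linear arithmetic. *)
Definition axd (x y : nat) : nat := (x - y) + (y - x).

Definition cdist (u v : point) : nat := axd u.1 v.1 + axd u.2 v.2.

Definition pt_of a b (u : grid a b) : point := (val u.1, val u.2).

Lemma pt_of_inj a b : injective (@pt_of a b).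
Proof. by move=> [x y] [x' y'] [] /val_inj -> /val_inj ->. Qed.

Lemma cdist_adj a b (u v : grid a b) :
  grid_adj u v = (cdist (pt_of u) (pt_of v) == 1).
Proof.
case: u v => [x y] [x' y']; rewrite /grid_adj /cdist /axd /=.
rewrite -!(inj_eq val_inj) /=; lia.
Qed.

Lemma cdist_walk a b (u v : grid a b) k :
  has_walk u v k -> cdist (pt_of u) (pt_of v) <= k.
Proof.
case/existsP=> [[p /= /eqP <-]] /andP[pth /eqP <-] {v k}.
elim: p u pth => [|v p IH] u /=; first by rewrite /cdist /axd; lia.
rewrite cdist_adj => /andP[/eqP uv /IH]; move: uv; rewrite /cdist /axd; lia.
Qed.

(** Induction on the distance: while it is positive, one coordinate moves by one unit towards the
    target, the first coordinate having priority. *)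
Lemma walk_cdist a b (u v : grid a b) :
  has_walk u v (cdist (pt_of u) (pt_of v)).
Proof.
suff [p Hp] : exists2 p : seq (grid a b), path (@adj (grid a b)) u p &
    last u p = v /\ size p = cdist (pt_of u) (pt_of v).
  by case=> Hl <-; apply/existsP; exists (in_tuple p); rewrite /= Hp Hl eqxx.
move En: (cdist _ _) => n; elim: n u En => [|n IH] u En.
  exists [::] => //; split => //; apply: pt_of_inj.
  move: En; rewrite /cdist /axd; case: (pt_of u) (pt_of v) => [? ?] [? ?] /= ?.
  by congr pair; lia.
suff [w uw wv] : exists2 w : grid a b, grid_adj u w & cdist (pt_of w) (pt_of v) = n.
  by have [p Hp [Hl Hs]] := IH w wv; exists (w :: p); rewrite /= ?uw ?Hs.
have adjE := @cdist_adj a b u.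
case: u v En adjE {IH} => [x y] [x' y']; rewrite /cdist /axd /= => En adjE.
have [lt_xa lt_yb lt_x'a lt_y'b] :=
  And4 (ltn_ord x) (ltn_ord y) (ltn_ord x') (ltn_ord y').
case: (ltngtP x x') => Hx.
- have H : x.+1 < a by lia.
  by exists (Ordinal H, y); rewrite ?adjE /=; lia.
- have H : x.-1 < a by lia.
  by exists (Ordinal H, y); rewrite ?adjE /=; lia.
case: (ltngtP y y') => Hy.
- have H : y.+1 < b by lia.
  by exists (x, Ordinal H); rewrite ?adjE /=; lia.
- have H : y.-1 < b by lia.
  by exists (x, Ordinal H); rewrite ?adjE /=; lia.
lia.
Qed.

Lemma dist_grid a b (u v : grid a b) : dist u v = cdist (pt_of u) (pt_of v).
Proof.
rewrite /dist; case: ex_minnP => k /cdist_walk le_k /(_ _ (walk_cdist u v)).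
by move=> ?; apply/eqP; rewrite eqn_leq le_k andbT.
Qed.

Lemma diam_grid a b : 0 < a -> 0 < b -> diam (grid a b) = a + b - 2.
Proof.
move=> a_gt0 b_gt0; apply/eqP; rewrite eqn_leq; apply/andP; split.
  apply/bigmax_leqP => -[x y] _; apply/bigmax_leqP => -[x' y'] _.
  rewrite dist_grid /cdist /axd /=.
  have := And4 (ltn_ord x) (ltn_ord y) (ltn_ord x') (ltn_ord y').
  by case; lia.
have [ha hb] : a.-1 < a /\ b.-1 < b by lia.
pose u0 : grid a b := (Ordinal a_gt0, Ordinal b_gt0).
pose u1 : grid a b := (Ordinal ha, Ordinal hb).
apply: leq_trans (leq_bigmax u0); apply: leq_trans (leq_bigmax u1).
by rewrite dist_grid /cdist /axd /=; lia.
Qed.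

(** * The radio number as a minimum, and its symmetry in the two sides *)

Lemma rn_le (G : connected_graph) (f : G -> nat) : radio_labeling f -> rn G <= Defs.span f.
Proof.
by move=> Hf; rewrite /rn; case: ex_minnP => k _; apply; apply/asboolP; exists f.
Qed.

Lemma rn_witness (G : connected_graph) :
  exists2 f : G -> nat, radio_labeling f & Defs.span f = rn G.
Proof. by rewrite /rn; case: ex_minnP => k /asboolP[f Hf <-] _; exists f. Qed.

Lemma leq_span (G : connected_graph) (f : G -> nat) u v : f u - f v <= Defs.span f.
Proof.
apply: leq_trans (leq_bigmax u); apply: leq_trans (leq_bigmax v).
by lia.
Qed.

Lemma radio_grid a b (f : grid a b -> nat) : 0 < a -> 0 < b ->
  radio_labeling f <-> forall u v, u != v -> f u <= f v ->
    a + b - 2 < f v - f u + cdist (pt_of u) (pt_of v).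
Proof.
move=> a_gt0 b_gt0; split=> [Hf u v neq le|Hf u v neq].
  by have := Hf u v neq; rewrite diam_grid // dist_grid; lia.
rewrite diam_grid // dist_grid.
have := Hf u v neq; have := Hf v u; rewrite eq_sym neq => /(_ isT).
rewrite /cdist /axd => H1 H2.
by case/orP: (leq_total (f u) (f v)) => le; [have := H2 le | have := H1 le]; lia.
Qed.

Lemma rn_grid_swap a b : 0 < a -> 0 < b -> rn (grid a b) <= rn (grid b a).
Proof.
move=> a_gt0 b_gt0; have [f /radio_grid Hf <-] := rn_witness (grid b a).
have {}Hf := Hf b_gt0 a_gt0.
pose g (u : grid a b) := f (u.2, u.1).
apply: leq_trans (_ : Defs.span g <= _); first apply: rn_le.
  apply/radio_grid => // -[x y] [x' y'] neq le.
  have neq' : (y, x) != (y', x') by apply: contra neq => /eqP[-> ->].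
  by have := Hf _ _ neq' le; rewrite /cdist /axd /g /=; lia.
apply/bigmax_leqP => u _; apply/bigmax_leqP => v _.
have := @leq_span (grid b a) f (u.2, u.1) (v.2, v.1).
have := @leq_span (grid b a) f (v.2, v.1) (u.2, u.1).
by rewrite /g; lia.
Qed.

(* The second component is a delay, added to the minimal gap before the vertex is labelled. *)
Notation stop := (point * nat)%type.

(** * Greedy labellings along a list of vertices *)

Definition gap (D : nat) (u v : stop) : nat := D.+1 - cdist u.1 v.1 + v.2.

Fixpoint total_gap (D : nat) (u : stop) (s : seq stop) : nat :=
  if s is v :: s' then gap D u v + total_gap D v s' else 0.

(** A point that occurs several times receives the label of its first occurrence; a point that never
    occurs receives the total gap. *)
Fixpoint label (D : nat) (u : stop) (s : seq stop) (x : point) : nat :=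
  if x == u.1 then 0 else
  if s is v :: s' then gap D u v + label D v s' x else 0.

(* Three consecutive gaps sum to at least the diameter, so longer windows need no condition. *)
Fixpoint radio_seq (D : nat) (u : stop) (s : seq stop) : bool :=
  if s is v :: s1 then
    [&& (if s1 is x :: s2 then
           (D < gap D u v + gap D v x + cdist u.1 x.1) &&
           (if s2 is y :: _ then D <= gap D u v + gap D v x + gap D x y else true)
         else true)
      & radio_seq D v s1]
  else true.

Lemma label_le_total D u s x : label D u s x <= total_gap D u s.
Proof.
by elim: s u => [|v s IH] u /=; case: eqP => // _; rewrite leq_add2l.
Qed.

Lemma label_start D u s x : x == u.1 -> label D u s x = 0.
Proof. by case: s => [|v s] /= ->. Qed.

(** The first two places after the head are settled by the definition of [gap] and by the window of
    three. From the third place on, three gaps already give [D], and a distinct point is at distance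
    at least 1. *)
Lemma radio_seq_start D u s x : radio_seq D u s -> x \in map fst s ->
  x != u.1 -> D < label D u s x + cdist u.1 x.
Proof.
case: s => [//|v s] /= /andP[Hs _]; rewrite in_cons => xs /negPf neu.
have dpos : 0 < cdist u.1 x.
  move: neu; case: (u.1) (x) => [? ?] [? ?]; rewrite /cdist /axd -pair_eqE /pair_eq /=; lia.
rewrite neu; case: (eqVneq x v.1) xs => [-> _|nev /= xs].
  by rewrite label_start // /gap; lia.
case: s xs Hs => [//|y s]; rewrite /= in_cons (negPf nev).
case: (eqVneq x y.1) => [-> _|ney /= xs] /andP[H2]; first by rewrite label_start //; lia.
case: s xs => [//|z s] _ H3; rewrite /= (negPf ney).
move: H3 dpos; lia.
Qed.

Lemma label_next D u v s x : x != u.1 -> label D u (v :: s) x = gap D u v + label D v s x.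
Proof. by move=> /negPf /= ->. Qed.

Lemma radio_seq_label D u s x y : radio_seq D u s ->
    x \in map fst (u :: s) -> y \in map fst (u :: s) -> x != y ->
    label D u s x <= label D u s y ->
  D < label D u s y - label D u s x + cdist x y.
Proof.
elim: s u => [|v s IH] u.
  by move=> _; rewrite !inE => /eqP-> /eqP->; rewrite eqxx.
move=> Hs; rewrite 2!map_cons 2!(in_cons u.1).
case: (boolP (x == u.1)) => [xu _|nex /orP[//|xs]].
  rewrite (label_start _ _ xu) (eqP xu) => /orP[/eqP-> | ys]; first by rewrite eqxx.
  by rewrite eq_sym subn0 => neq _; apply: radio_seq_start.
case: (boolP (y == u.1)) => [yu _ _|ney /orP[//|ys] neq].
  rewrite (label_start _ _ yu) (eqP yu) => le.
  have := radio_seq_start Hs xs nex.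
  by move: le; rewrite /cdist /axd; lia.
rewrite !label_next // leq_add2l subnDl => le.
by apply: IH => //; case/andP: Hs.
Qed.

Lemma rn_grid_le_total a b u s : 0 < a -> 0 < b ->
    (forall x y, x < a -> y < b -> (x, y) \in map fst (u :: s)) ->
  radio_seq (a + b - 2) u s -> rn (grid a b) <= total_gap (a + b - 2) u s.
Proof.
move=> a_gt0 b_gt0 cover Hs.
pose f (v : grid a b) := label (a + b - 2) u s (pt_of v).
have mem_pt v : @pt_of a b v \in map fst (u :: s).
  by apply: cover; apply: ltn_ord.
apply: leq_trans (rn_le (f := f) _) _.
  apply/radio_grid => // v w neq le; apply: radio_seq_label => //.
apply/bigmax_leqP => v _; apply/bigmax_leqP => w _.
have := label_le_total (a + b - 2) u s (pt_of v).
have := label_le_total (a + b - 2) u s (pt_of w).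
by rewrite /f; lia.
Qed.

(** * Weights, and the total gap of a list without loss *)

Definition axw (n x : nat) : nat := axd (2 * x) n.-1.

(* Twice the distance to the centre of the grid. *)
Definition wt (a b : nat) (u : point) : nat := axw a u.1 + axw b u.2.

Lemma axd_le_axw n x y : 2 * axd x y <= axw n x + axw n y.
Proof. by rewrite /axw /axd; lia. Qed.

Lemma cdist_le_wt a b u v : 2 * cdist u v <= wt a b u + wt a b v.
Proof.
by rewrite /cdist /wt; have := axd_le_axw a u.1 v.1; have := axd_le_axw b u.2 v.2; lia.
Qed.

(** Equality in [cdist_le_wt]; the second condition keeps the subtraction in [gap] from
    truncating. *)
Definition tight (a b : nat) (u v : stop) : bool :=
  (wt a b u.1 + wt a b v.1 == 2 * cdist u.1 v.1) && (cdist u.1 v.1 <= a + b - 2).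

(** A tight gap is [D + 1] plus the delay minus half of the two weights, where [D = a + b - 2]. In
    the sum every weight occurs twice, except those of the two ends. *)
Lemma total_tight a b u s : path (tight a b) u s ->
  2 * total_gap (a + b - 2) u s + wt a b u.1 + 2 * (\sum_(v <- s) wt a b v.1) =
  2 * ((a + b - 2).+1 * size s) + 2 * (\sum_(v <- s) v.2) + wt a b (last u s).1.
Proof.
elim: s u => [|v s IH] u /=; first by rewrite !big_nil; lia.
rewrite !big_cons /tight => /andP[/andP[/eqP Ht le] /IH]; rewrite /gap.
move: (total_gap _ _ _) (\sum_(_ <- _) _) (\sum_(_ <- _) _) (wt _ _ (last _ _).1).
by move=> T W E w; rewrite mulnS; lia.
Qed.

Lemma total_cat D u s v t :
  total_gap D u (s ++ v :: t) = total_gap D u s + gap D (last u s) v + total_gap D v t.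
Proof. by elim: s u => [|x s IH] u //=; rewrite IH !addnA. Qed.

(** * Lists made of dominoes *)

Notation domino := (stop * stop)%type.

Definition dflat (L : seq domino) : seq stop := flatten [seq [:: d.1; d.2] | d <- L].

(** The bound is [D + 3]: two such sums and two single weights, each at most [D], make the
    [4 * D + 6] of [three_gaps]. *)
Definition dom (a b : nat) (d : domino) : bool :=
  wt a b d.1.1 + wt a b d.2.1 <= a + b + 1.

(** These are the two windows of three that meet both dominoes. *)
Definition rstep (D : nat) (d d' : domino) : bool :=
  (D < gap D d.1 d.2 + gap D d.2 d'.1 + cdist d.1.1 d'.1.1) &&
  (D < gap D d.2 d'.1 + gap D d'.1 d'.2 + cdist d.2.1 d'.2.1).

Lemma wt_corner a b u : u.1 < a -> u.2 < b -> wt a b u <= a + b - 2.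
Proof. by rewrite /wt /axw /axd; lia. Qed.

(** The three distances sum to at most half of the weighted sum, that is [2 * D + 3], so the gaps
    sum to at least [3 * (D + 1) - (2 * D + 3) = D]. *)
Lemma three_gaps a b (u v x y : stop) :
    wt a b u.1 + 2 * wt a b v.1 + 2 * wt a b x.1 + wt a b y.1 <= 4 * (a + b - 2) + 6 ->
  a + b - 2 <= gap (a + b - 2) u v + gap (a + b - 2) v x + gap (a + b - 2) x y.
Proof.
have := cdist_le_wt a b u.1 v.1; have := cdist_le_wt a b v.1 x.1.
by have := cdist_le_wt a b x.1 y.1; rewrite /gap; lia.
Qed.

Definition in_grid (a b : nat) (u : stop) : bool := (u.1.1 < a) && (u.1.2 < b).

Definition din_grid (a b : nat) (d : domino) : bool := in_grid a b d.1 && in_grid a b d.2.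

Lemma radio_seq_cons2 D u v x s : radio_seq D u [:: v, x & s] =
  [&& D < gap D u v + gap D v x + cdist u.1 x.1,
      (if s is y :: _ then D <= gap D u v + gap D v x + gap D x y else true)
    & radio_seq D v (x :: s)].
Proof. by rewrite /= -andbA. Qed.

(** A window of four consists of two dominoes, or of one domino between two halves. With
    coefficients 1, 2, 2, 1 its weights amount in both cases to two domino sums and two single
    weights. *)
Lemma radio_seq_dflat a b L d : 2 < a + b ->
    all (dom a b) (d :: L) -> all (din_grid a b) (d :: L) ->
    path (rstep (a + b - 2)) d L ->
  radio_seq (a + b - 2) d.1 (d.2 :: dflat L).
Proof.
move=> ab; elim: L d => [//|d' L IH] d.
rewrite [all (dom _ _) _]/= [all (din_grid _ _) _]/= [path _ _ _]/=.
case/andP=> dd dL /andP[/andP[/andP[g1 g1'] /andP[g2 g2']]] gL /andP[/andP[r1 r2] pL].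
have {}IH := IH d' dL gL pL.
case/andP: dL => dd' dL; case/andP: gL => /andP[/andP[g3 g3'] /andP[g4 g4']] gL.
have c2 := wt_corner g2 g2'; have c3 := wt_corner g3 g3'.
rewrite /dom in dd dd'.
rewrite [dflat _]/= -/(dflat L).
change (radio_seq (a + b - 2) d.1 [:: d.2, d'.1, d'.2 & dflat L]).
rewrite 2!radio_seq_cons2 IH r1; apply/and3P; split => //.
  by apply: three_gaps; lia.
rewrite r2 andbT; case: L pL dL gL {IH} => [//|d'' L] /= _ /andP[dd'' _].
case/andP=> [/andP[/andP[g5 g5'] _] _]; have c5 := wt_corner g5 g5'.
by rewrite /dom in dd''; apply: three_gaps; lia.
Qed.

(** * The sum of the weights of all vertices *)

Definition gridpts (a b : nat) : seq point := [seq (x, y) | x <- iota 0 a, y <- iota 0 b].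

Lemma mem_gridpts a b x y : ((x, y) \in gridpts a b) = (x < a) && (y < b).
Proof.
apply/allpairsP/andP => [[[x' y'] /= [] ]|[xa yb]].
  by rewrite !mem_iota /= !add0n => xa yb [-> ->].
by exists (x, y); rewrite !mem_iota.
Qed.

(** A covering list of the length of the grid has no room for a repetition. *)
Lemma perm_gridpts a b (t : seq point) :
    (forall x y, x < a -> y < b -> (x, y) \in t) -> size t = a * b ->
  perm_eq t (gridpts a b).
Proof.
move=> cover sz.
have U : uniq (gridpts a b).
  by apply: allpairs_uniq; rewrite ?iota_uniq // => -[? ?] [? ?].
have S : {subset gridpts a b <= t}.
  by move=> [x y]; rewrite mem_gridpts => /andP[]; apply: cover.
have L : size t <= size (gridpts a b) by rewrite size_allpairs !size_iota sz.
apply: uniq_perm => //; first exact: leq_size_uniq L.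
by have [_] := uniq_min_size U S L => E z; rewrite E.
Qed.

(** Induction in steps of two: removing both ends of the axis leaves a shifted copy of the axis with
    two points fewer and the same centre. *)
Lemma sum_axis n :
  \sum_(0 <= x < n) axw n x = (n * n)./2.
Proof.
rewrite /axw /axd.
have [m] := ubnP n; elim: m n => // m IH [|[|n]] lt_nm.
- by rewrite big_geq.
- by rewrite big_nat1.
rewrite big_nat_recl // big_nat_recr //=.
rewrite (eq_big_nat _ _ (F2 := fun x => 2 * x - n.-1 + (n.-1 - 2 * x))).
  by rewrite IH; lia.
by move=> i; lia.
Qed.

Definition wt_sum a b := b * (a * a)./2 + a * (b * b)./2.

Lemma sum_wt a b (t : seq point) :
    (forall x y, x < a -> y < b -> (x, y) \in t) -> size t = a * b ->
  \sum_(v <- t) wt a b v = wt_sum a b.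
Proof.
move=> cover sz; rewrite (perm_big _ (perm_gridpts cover sz)) /= big_allpairs_dep /=.
have iE n : iota 0 n = index_iota 0 n by rewrite /index_iota subn0.
rewrite /wt /= !iE.
under eq_bigr => x _ do rewrite big_split /= sum_axis sum_nat_const_nat subn0.
by rewrite big_split /= sum_nat_const_nat -big_distrr /= sum_axis subn0.
Qed.

Lemma rn_grid_tight a b u s : 0 < a -> 0 < b ->
    (forall x y, x < a -> y < b -> (x, y) \in map fst (u :: s)) ->
    size (u :: s) = a * b -> radio_seq (a + b - 2) u s ->
    path (tight a b) u s -> all (fun v => v.2 == 0) s ->
  2 * rn (grid a b) + 2 * wt_sum a b <=
  2 * ((a + b - 2).+1 * (a * b).-1) + wt a b u.1 + wt a b (last u s).1.
Proof.
move=> a_gt0 b_gt0 cover sz rs /total_tight E /allP Z.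
have := rn_grid_le_total a_gt0 b_gt0 cover rs.
have := sum_wt cover; rewrite size_map => /(_ sz).
rewrite /= big_cons big_map; move: E; rewrite -sz /=.
have -> : \sum_(v <- s) v.2 = 0 by rewrite big1_seq // => v /andP[_ /Z /eqP].
lia.
Qed.

(** * An optimal labelling in increasing order, and its losses *)

Lemma grid_order a b : 0 < a -> 0 < b ->
  exists (P : nat -> point) (F : nat -> nat),
  [/\ forall x y, x < a -> y < b -> exists2 i, i < a * b & P i = (x, y),
      forall i, i < a * b -> (P i).1 < a /\ (P i).2 < b,
      forall i j, i < j -> j < a * b ->
        [/\ F i <= F j, P i != P j & a + b - 2 < F j - F i + cdist (P i) (P j)],
      F (a * b).-1 - F 0 <= rn (grid a b)
    & \sum_(0 <= i < a * b) wt a b (P i) = wt_sum a b].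
Proof.
move=> a_gt0 b_gt0; have [f /radio_grid Hf <-] := rn_witness (grid a b).
have {}Hf := Hf a_gt0 b_gt0.
pose leqf (u v : grid a b) := f u <= f v.
pose s := sort leqf (enum (grid a b)).
pose u0 : grid a b := (Ordinal a_gt0, Ordinal b_gt0).
have sz : size s = a * b.
  by rewrite size_sort -cardE card_prod !card_ord.
have ss : sorted leqf s by apply: sort_sorted => u v; apply: leq_total.
have us : uniq s by rewrite sort_uniq enum_uniq.
have trf : transitive leqf by move=> y x z; apply: leq_trans.
(* [P i] is the vertex of rank [i] by label and [F i] is its label. The default [u0] is never
   reached for [i < a * b]. *)
exists (fun i => pt_of (nth u0 s i)), (fun i => f (nth u0 s i)); split.
- move=> x y xa yb; pose u : grid a b := (Ordinal xa, Ordinal yb).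
  have us' : u \in s by rewrite mem_sort mem_enum.
  by exists (index u s); rewrite ?nth_index // -sz index_mem.
- by move=> i _; case: (nth u0 s i) => x y /=; rewrite !ltn_ord.
- move=> i j ij; rewrite -sz => js.
  have is' : i < size s by apply: ltn_trans js.
  have le : f (nth u0 s i) <= f (nth u0 s j).
    by apply: (sorted_ltn_nth trf).
  have neq : nth u0 s i != nth u0 s j by rewrite nth_uniq // ltn_eqF.
  by split => //; apply: Hf.
- exact: leq_span.
rewrite -[LHS](big_map (fun i => pt_of (nth u0 s i)) xpredT (wt a b)).
apply: sum_wt; last by rewrite size_map size_iota subn0.
move=> x y xa yb; pose u : grid a b := (Ordinal xa, Ordinal yb).
have us' : u \in s by rewrite mem_sort mem_enum.
apply/mapP; exists (index u s); last by rewrite nth_index.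
by rewrite mem_index_iota -sz index_mem.
Qed.

(** [e i] is twice the excess of the gap at [i] over the least value that the weights allow; it
    collects both a pair that is not tight and a gap longer than required. Adding the equations
    telescopes, and only the end weights are not counted twice. *)
Lemma rn_grid_loss a b : 0 < a -> 0 < b ->
  exists (P : nat -> point) (F e : nat -> nat),
  [/\ forall x y, x < a -> y < b -> exists2 i, i < a * b & P i = (x, y),
      forall i, i < a * b -> (P i).1 < a /\ (P i).2 < b,
      forall i j, i < j -> j < a * b ->
        [/\ F i <= F j, P i != P j & a + b - 2 < F j - F i + cdist (P i) (P j)],
      forall i, i.+1 < a * b ->
        2 * (F i.+1 - F i) + wt a b (P i) + wt a b (P i.+1) = 2 * (a + b - 2).+1 + e i
    & 2 * ((a + b - 2).+1 * (a * b).-1) + wt a b (P 0) + wt a b (P (a * b).-1) +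
        \sum_(0 <= i < (a * b).-1) e i <= 2 * rn (grid a b) + 2 * wt_sum a b].
Proof.
move=> a_gt0 b_gt0; have [P [F [cov ing rad le_rn sumP]]] := grid_order a_gt0 b_gt0.
(* This subtraction is exact, by the radio condition and [cdist_le_wt]. *)
pose e i := 2 * (F i.+1 - F i) + wt a b (P i) + wt a b (P i.+1) - 2 * (a + b - 2).+1.
have eE i : i.+1 < a * b ->
    2 * (F i.+1 - F i) + wt a b (P i) + wt a b (P i.+1) = 2 * (a + b - 2).+1 + e i.
  move=> lt; have [le1 _ lt1] := rad _ _ (ltnSn i) lt.
  by have := cdist_le_wt a b (P i) (P i.+1); rewrite /e; lia.
exists P, F, e; split => //.
suff H m : m < a * b -> 2 * ((a + b - 2).+1 * m) + wt a b (P 0) + wt a b (P m) +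
    \sum_(0 <= i < m) e i = 2 * (F m - F 0) + 2 * (\sum_(0 <= i < m.+1) wt a b (P i)).
  have ab0 : 0 < a * b by rewrite muln_gt0 a_gt0.
  rewrite H ?prednK // sumP; lia.
elim: m => [|m IH] lt; first by rewrite big_nat1 big_geq //; lia.
have := IH (ltnW lt); have := eE m lt.
rewrite [in X in _ -> _ -> X]big_nat_recr //= [in X in _ -> _ -> _ = X]big_nat_recr //=.
have [le1 _ _] := rad m m.+1 (ltnSn m) lt.
have le0 : F 0 <= F m by case: (m) lt => // m' /ltnW lt'; case: (rad 0 m'.+1 isT lt').
rewrite mulnS; lia.
Qed.

(** * Lower bounds when some side is odd *)

Lemma rn_lower_eo a b : 0 < a -> 0 < b -> ~~ odd a -> odd b ->
  2 * ((a + b - 2).+1 * (a * b).-1) + 2 <= 2 * rn (grid a b) + 2 * wt_sum a b.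
Proof.
move=> a_gt0 b_gt0 ea ob; have [P [F [e [_ ing _ _]]]] := rn_grid_loss a_gt0 b_gt0.
have ab0 : 0 < a * b by rewrite muln_gt0 a_gt0.
(* As [a] is even, no vertex lies on the middle line of the first axis, so each end weighs at least
   1. *)
have wt1 i : i < a * b -> 0 < wt a b (P i).
  by move=> /ing; rewrite /wt /axw /axd; lia.
have := wt1 0 ab0; have := wt1 (a * b).-1; rewrite ltn_predL ab0 => /(_ isT); lia.
Qed.

Lemma rn_lower_oo a b : 1 < a -> 0 < b -> odd a -> odd b ->
  2 * ((a + b - 2).+1 * (a * b).-1) + 2 <= 2 * rn (grid a b) + 2 * wt_sum a b.
Proof.
move=> a_gt1 b_gt0 oa ob; have a_gt0 := ltnW a_gt1.
have [P [F [e [_ ing rad _]]]] := rn_grid_loss a_gt0 b_gt0.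
have ab1 : 1 < a * b by apply: leq_trans (leq_pmulr _ b_gt0).
have lt0 : 0 < (a * b).-1 by lia.
have ltn : (a * b).-1 < a * b by lia.
have [_ neq _] := rad 0 (a * b).-1 lt0 ltn.
have [h0 h0'] := ing 0 (ltnW ab1); have [h1 h1'] := ing _ ltn.
(* Only the centre has weight 0, all other weights are at least 2, and the two ends are distinct. *)
suff : 2 <= wt a b (P 0) + wt a b (P (a * b).-1) by lia.
move: neq h0 h0' h1 h1'; case: (P 0) (P _) => [x y] [x' y'].
rewrite -pair_eqE /pair_eq /wt /axw /axd /=; lia.
Qed.

(** * Lower bound when both sides are even *)

Lemma sum_pick3 m (e : nat -> nat) i j k : i < m -> j < m -> k < m ->
  i != j -> i != k -> j != k -> e i + e j + e k <= \sum_(0 <= l < m) e l.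
Proof.
move=> im jm km ij ik jk; rewrite big_mkord.
rewrite (bigD1 (Ordinal im)) // (bigD1 (Ordinal jm)) /=; last first.
  by rewrite -val_eqE /= eq_sym.
rewrite (bigD1 (Ordinal km)) /=; last first.
  by rewrite -!val_eqE /= eq_sym ik eq_sym jk.
by lia.
Qed.

Lemma sum_pick1 m (e : nat -> nat) i : i < m -> e i <= \sum_(0 <= l < m) e l.
Proof. by move=> im; rewrite big_mkord (bigD1 (Ordinal im)) //=; lia. Qed.

Definition opposite (h k : nat) (u v : point) : bool :=
  ((u.1 < h) != (v.1 < h)) && ((u.2 < k) != (v.2 < k)).

Definition diag_class (h k : nat) (u : point) : bool := (u.1 < h) == (u.2 < k).

Lemma opposite_diag h k u v : opposite h k u v -> diag_class h k u = diag_class h k v.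
Proof. by rewrite /opposite /diag_class; do 4!case: (_ < _). Qed.

(** On one side of the centre, [2 * axd x y] is the difference of the two axis weights. The slack is
    twice the smaller one, which is at least 1 on an even axis. *)
Lemma axd_same_side h x y : (x < h) = (y < h) -> x < 2 * h -> y < 2 * h ->
  2 * axd x y + 2 <= axw (2 * h) x + axw (2 * h) y.
Proof. by rewrite /axw /axd; case: (ltnP x h) (ltnP y h) => ? [] //; lia. Qed.

Lemma loss_not_opposite h k u v : ~~ opposite h k u v ->
    u.1 < 2 * h -> u.2 < 2 * k -> v.1 < 2 * h -> v.2 < 2 * k ->
  2 * cdist u v + 2 <= wt (2 * h) (2 * k) u + wt (2 * h) (2 * k) v.
Proof.
rewrite /opposite negb_and !negbK /cdist /wt => /orP[]/eqP E h1 h2 h3 h4.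
  by have := axd_same_side E h1 h3; have := axd_le_axw (2 * k) u.2 v.2; lia.
by have := axd_same_side E h2 h4; have := axd_le_axw (2 * h) u.1 v.1; lia.
Qed.

(** Both [u] and [v] lie in the quadrant opposite to that of [c], so each axis contributes a slack
    of 2. *)
Lemma corner_neighbours h k c u v :
    u.1 < 2 * h -> u.2 < 2 * k -> v.1 < 2 * h -> v.2 < 2 * k ->
    opposite h k u c -> opposite h k c v ->
  2 * cdist u v + 4 <= wt (2 * h) (2 * k) u + wt (2 * h) (2 * k) v.
Proof.
rewrite /opposite /cdist /wt => h1 h2 h3 h4 /andP[H1 H2] /andP[H3 H4].
have E1 : (u.1 < h) = (v.1 < h) by move: H1 H3; do 3!case: (_ < h).
have E2 : (u.2 < k) = (v.2 < k) by move: H2 H4; do 3!case: (_ < k).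
by have := axd_same_side E1 h1 h3; have := axd_same_side E2 h2 h4; lia.
Qed.

Lemma corner_coord h k u : u.1 < 2 * h -> u.2 < 2 * k ->
  wt (2 * h) (2 * k) u = 2 * h + 2 * k - 2 ->
  (u.1 = 0 \/ u.1 = (2 * h).-1) /\ (u.2 = 0 \/ u.2 = (2 * k).-1).
Proof. by rewrite /wt /axw /axd; lia. Qed.

(** Two such corners share exactly one coordinate. Their distance is one side minus 1, which falls
    short of the diameter by the other side minus 1, at least 3. *)
Lemma corner_switch h k c c' : 1 < h -> 1 < k ->
    c.1 < 2 * h -> c.2 < 2 * k -> c'.1 < 2 * h -> c'.2 < 2 * k ->
    wt (2 * h) (2 * k) c = 2 * h + 2 * k - 2 ->
    wt (2 * h) (2 * k) c' = 2 * h + 2 * k - 2 ->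
    diag_class h k c != diag_class h k c' ->
  2 * cdist c c' + 6 <= 2 * (2 * h + 2 * k - 2).
Proof.
move=> h1 k1 i1 i2 i3 i4 /(corner_coord i1 i2)[[e1|e1] [e2|e2]];
move=> /(corner_coord i3 i4)[[e3|e3] [e4|e4]];
rewrite /diag_class /cdist /axd e1 e2 e3 e4; lia.
Qed.

(* If the bound failed, at most two consecutive pairs would have a positive loss [e]. Each of the
   four corners belongs to one of them, so these two pairs are made of corners; one of them changes
   the diagonal class, and a pair of corners of different classes loses too much. *)
Lemma rn_lower_ee h k : 1 < h -> 1 < k ->
  2 * ((2 * h + 2 * k - 2).+1 * (2 * h * (2 * k)).-1) + 10 <=
  2 * rn (grid (2 * h) (2 * k)) + 2 * wt_sum (2 * h) (2 * k).
Proof.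
move=> h1 k1; set a := 2 * h; set b := 2 * k.
have [a_gt0 b_gt0] : 0 < a /\ 0 < b by rewrite /a /b; lia.
have [P [F [e [cov ing rad eE bound]]]] := rn_grid_loss a_gt0 b_gt0.
set D := a + b - 2 in rad eE bound *; set n := a * b in cov ing rad eE bound *.
have n_gt3 : 3 < n by rewrite /n /a /b; nia.
pose w i := wt a b (P i).
have w_ge2 i : i < n -> 2 <= w i.
  by case/ing; rewrite /w /wt /axw /axd /a /b; lia.
have w_even i : i < n -> ~~ odd (w i).
  by case/ing; rewrite /w /wt /axw /axd /a /b; lia.
have e_even i : i.+1 < n -> ~~ odd (e i).
  move=> lt; have := eE i lt; have := w_even i (ltnW lt); have := w_even _ lt.
  by rewrite /w; lia.
have e_opp i : i.+1 < n -> e i = 0 -> opposite h k (P i) (P i.+1).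
  move=> lt ei0; apply/negP => /negP /loss_not_opposite.
  have [i1 i2] := ing _ (ltnW lt); have [i3 i4] := ing _ lt.
  move=> /(_ i1 i2 i3 i4); have [_ _ r] := rad _ _ (ltnSn i) lt.
  by have := eE i lt; rewrite ei0 -/a -/b; lia.
(* With no loss on either side of a corner of weight [D], the label difference of its two neighbours
   is [D + 2] minus half their weights. By [corner_neighbours] this plus their distance is at most
   [D]. *)
have corner_loss i : 0 < i -> i.+1 < n -> w i = D -> 0 < e i.-1 + e i.
  case: i => // i _ lt /= wD; rewrite lt0n addn_eq0; apply/negP => /andP[/eqP e0 /eqP e1].
  have := corner_neighbours _ _ _ _ (e_opp i (ltnW lt) e0) (e_opp i.+1 lt e1).
  have [i1 i2] := ing _ (ltnW (ltnW lt)); have [i3 i4] := ing _ lt.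
  move=> /(_ i1 i2 i3 i4).
  have lt2 : i < i.+2 by lia.
  have [_ _ r] := rad _ _ lt2 lt.
  have [r1 _ _] := rad _ _ (ltnSn i) (ltnW lt).
  have [r2 _ _] := rad _ _ (ltnSn i.+1) lt.
  have := eE i (ltnW lt); have := eE i.+1 lt; rewrite e0 e1.
  rewrite -!/(w _) wD -/a -/b; lia.
have [c1 c1n P1] := cov 0 0 a_gt0 b_gt0.
have [a1 b1] : a.-1 < a /\ b.-1 < b by lia.
have [c2 c2n P2] := cov a.-1 b.-1 a1 b1.
have [c3 c3n P3] := cov 0 b.-1 a_gt0 b1.
have [c4 c4n P4] := cov a.-1 0 a1 b_gt0.
have wcs : [/\ w c1 = D, w c2 = D, w c3 = D & w c4 = D].
  by rewrite /w P1 P2 P3 P4 /wt /axw /axd /D /=; split; lia.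
have neqs : [/\ c1 != c2, c1 != c3 & c1 != c4] /\ [/\ c2 != c3, c2 != c4 & c3 != c4].
  have neq i j : P i != P j -> i != j by apply: contra => /eqP->.
  split; split; apply: neq; rewrite ?P1 ?P2 ?P3 ?P4 -pair_eqE /pair_eq /= /a /b; lia.
pose cl i := diag_class h k (P i).
(* The class changes somewhere, since the corners at [c1] and [c3] have different classes. *)
have [s sn cls] : exists2 s, s.+1 < n & cl s != cl s.+1.
  case: (boolP [exists s : 'I_n.-1, cl s != cl s.+1]).
    by case/existsP => s H; exists s => //; have := ltn_ord s; lia.
  rewrite negb_exists => /forallP H.
  have cl0 i : i < n -> cl i = cl 0.
    elim: i => // i IH lt; have lt' : i < n.-1 by lia.
    by have := H (Ordinal lt'); rewrite negbK /= => /eqP <-; apply: IH; apply: ltnW.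
  have := cl0 c1 c1n; rewrite -(cl0 c3 c3n) /cl P1 P3 /diag_class /= /b; lia.
have es0 : 2 <= e s.
  have := e_even s sn; have := e_opp s sn.
  case: (e s) => [/(_ erefl)/opposite_diag E|[|m]] //.
  by move: cls; rewrite /cl E eqxx.
rewrite leqNgt; apply/negP => small.
have {small bound} sum_small : w 0 + w n.-1 + \sum_(0 <= i < n.-1) e i <= 9.
  by move: bound small; rewrite /w; lia.
have D6 : 6 <= D by rewrite /D /a /b; lia.
have n0 : 0 < n by lia. have nn : n.-1 < n by lia.
have w0 := w_ge2 0 n0; have wn := w_ge2 n.-1 nn.
have sm : s < n.-1 by lia.
(* A corner at an end would give at least [6 + 2 + 2]: its weight, the other end and the loss at
   [s]. *)
have inner i : i < n -> w i = D -> 0 < i /\ i.+1 < n.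
  move=> lt wD; have := sum_pick1 e sm.
  case: (eqVneq i 0) => [i0|i0]; first by move: wD; rewrite i0; lia.
  case: (eqVneq i n.-1) => [i1|i1]; first by move: wD; rewrite i1; lia.
  by split; lia.
(* The end weights leave at most 5 for the losses. These are even, so three positive ones, of sum at
   least 6, are impossible. *)
have [t tP] : exists t, forall i, i.+1 < n -> 0 < e i -> (i == s) || (i == t).
  case: (boolP [exists t : 'I_n.-1, (t != s :> nat) && (0 < e t)]).
    case/existsP => -[t tm] /= /andP[ts et]; exists t => i lt ei; apply/negP => /negP.
    rewrite negb_or => /andP[is' it].
    have im : i < n.-1 by lia.
    have := sum_pick3 e sm tm im; rewrite eq_sym ts (eq_sym s) is' (eq_sym _ i) it.
    have tn : t.+1 < n by lia.
    have := e_even i lt; have := e_even t tn; move=> A1 A2 /(_ isT isT isT).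
    lia.
  rewrite negb_exists => /forallP H; exists s => i lt ei.
  have im : i < n.-1 by lia.
  by have := H (Ordinal im); rewrite negb_and negbK /= ei orbF orbb.
have incident i : i < n -> w i = D ->
    [|| i == s, i == s.+1, i == t | i == t.+1].
  move=> lt wD; have [i0 i1] := inner i lt wD.
  have := corner_loss i i0 i1 wD; rewrite addn_gt0 => /orP[] ei.
    have lt' : i.-1.+1 < n by lia.
    by have := tP _ lt' ei; lia.
  by have := tP _ i1 ei; lia.
have [wss wss'] : w s = D /\ w s.+1 = D.
  case: wcs neqs => W1 W2 W3 W4 [[N1 N2 N3] [N4 N5 N6]].
  have I1 := incident c1 c1n W1; have I2 := incident c2 c2n W2.
  have I3 := incident c3 c3n W3; have I4 := incident c4 c4n W4.
  suff [E1 E2] : (s \in [:: c1; c2; c3; c4]) /\ (s.+1 \in [:: c1; c2; c3; c4]).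
    by split; [move: E1 | move: E2]; rewrite !inE => /or4P[]/eqP->.
  pose cs := [:: c1; c2; c3; c4].
  have U : uniq cs by rewrite /= !inE !negb_or N1 N2 N3 N4 N5 N6.
  have S : {subset cs <= [:: s; s.+1; t; t.+1]}.
    by move=> c; rewrite !inE => /or4P[]/eqP->.
  (* Four distinct corner indices inside a list of length four exhaust it, so [s] and [s.+1] are
     corner indices. *)
  have [_ E] := uniq_min_size U S (leqnn _).
  by rewrite -/cs !E !inE !eqxx ?orbT.
have [i1 i2] := ing _ (ltnW sn); have [i3 i4] := ing _ sn.
(* The gap at [s] is now at least 4 while both weights equal [D], so [e s] is at least 6, more than
   the 5 available. *)
have := corner_switch h1 k1 i1 i2 i3 i4 wss wss' cls.
have := eE s sn; have [_ _ r] := rad _ _ (ltnSn s) sn.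
have := sum_pick1 e sm.
by rewrite -!/(w _) wss wss' -/a -/b -/D; lia.
Qed.

(** * Rectangles of cells in lexicographic order *)

Definition cells (x0 m y0 n : nat) : seq point :=
  [seq (x, y) | x <- iota x0 m, y <- iota y0 n].

Lemma mem_cells x0 m y0 n x y :
  ((x, y) \in cells x0 m y0 n) = (x0 <= x < x0 + m) && (y0 <= y < y0 + n).
Proof.
rewrite -!mem_iota; apply/allpairsP/andP => [[[x' y'] /= [xi yi [-> ->]]] //|[xi yi]].
by exists (x, y).
Qed.

Lemma size_cells x0 m y0 n : size (cells x0 m y0 n) = m * n.
Proof. by rewrite size_allpairs !size_iota. Qed.

Lemma head_cells z x0 m y0 n : 0 < m -> 0 < n -> head z (cells x0 m y0 n) = (x0, y0).
Proof. by case: m n => [//|m] [|n]. Qed.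

Lemma last_cells z x0 m y0 n : 0 < m -> 0 < n ->
  last z (cells x0 m y0 n) = (x0 + m.-1, y0 + n.-1).
Proof.
case: m n => [//|m] [//|n] _ _; rewrite /cells -[in LHS](addn1 m) iotaD allpairs_cat last_cat.
by rewrite allpairs1l -[in LHS](addn1 n) iotaD map_cat last_cat.
Qed.

Definition lexlt (u v : point) : bool := (u.1 < v.1) || (u.1 == v.1) && (u.2 < v.2).

Lemma pairwise_iota m n : pairwise ltn (iota m n).
Proof. by rewrite -(sorted_pairwise ltn_trans) iota_ltn_sorted. Qed.

Lemma pairwise_cells x0 m y0 n : pairwise lexlt (cells x0 m y0 n).
Proof.
elim: m x0 => [//|m IH] x0; rewrite /cells /= -/(cells _ _ _ _) pairwise_cat IH andbT.
apply/andP; split.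
  apply/allrelP => u [x y] /mapP[y' _ ->].
  by rewrite mem_cells /lexlt /= => /andP[/andP[-> _]].
rewrite pairwise_map; apply: sub_pairwise (pairwise_iota y0 n) => y y' /=.
by rewrite /lexlt /= eqxx ltnn.
Qed.

(** Steps are verified for all lexicographically increasing pairs, which avoids describing the
    successor of a cell. *)
Lemma sorted_map_cells (T : Type) (R : rel T) (N : point -> T) (s : seq point) :
    pairwise lexlt s ->
    {in s &, forall u v, lexlt u v -> R (N u) (N v)} ->
  sorted R (map N s).
Proof.
move=> ps RN; apply: pairwise_sorted; rewrite pairwise_map.
have RN' : {in s &, subrel lexlt (relpre N R)} by [].
by apply: (sub_in_pairwise RN') ps; apply/allP.
Qed.

Lemma sorted_cat (T : Type) (R : rel T) z (s t : seq T) :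
    sorted R s -> sorted R t -> 0 < size s -> 0 < size t ->
    R (last z s) (head z t) -> sorted R (s ++ t).
Proof.
by case: s t => [//|x s] [//|y t] /= ps pt _ _ r; rewrite cat_path ps /= r.
Qed.

Lemma dflat_cat s t : dflat (s ++ t) = dflat s ++ dflat t.
Proof. by rewrite /dflat map_cat flatten_cat. Qed.

Lemma size_dflat s : size (dflat s) = 2 * size s.
Proof. by elim: s => //= d s; rewrite /dflat /= => ->; rewrite mulnS. Qed.

Lemma mem_dflat (L : seq domino) (d : domino) x : d \in L -> (x == d.1.1) || (x == d.2.1) ->
  x \in map fst (dflat L).
Proof.
elim: L => [//|d' L IH]; rewrite in_cons /dflat /= !in_cons -/(dflat L) => /orP[/eqP->|dL H].
  by rewrite orbA => ->.
by rewrite (IH dL H) !orbT.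
Qed.

(** * Tight dominoes and the steps between them *)

Definition straddle (n x y : nat) : bool :=
  (2 * x <= n.-1 <= 2 * y) || (2 * y <= n.-1 <= 2 * x).

Lemma axd_straddle n x y : straddle n x y -> axw n x + axw n y = 2 * axd x y.
Proof. by rewrite /straddle /axw /axd; lia. Qed.

Definition zstop (u : point) : stop := (u, 0).

Lemma tightI a b (u v : stop) :
    straddle a u.1.1 v.1.1 -> straddle b u.1.2 v.1.2 -> in_grid a b u -> in_grid a b v ->
  tight a b u v.
Proof.
move=> /axd_straddle E1 /axd_straddle E2 /andP[h1 h2] /andP[h3 h4].
rewrite /tight /wt /cdist; apply/andP; split; first by apply/eqP; lia.
have : axd u.1.1 v.1.1 < a by rewrite /axd; lia.
have : axd u.1.2 v.1.2 < b by rewrite /axd; lia.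
lia.
Qed.

Lemma rstepI D (d d' : domino) :
    cdist d.1.1 d.2.1 + cdist d.2.1 d'.1.1 <=
      D.+1 + cdist d.1.1 d'.1.1 + (d.2.2 + d'.1.2) ->
    cdist d.2.1 d'.1.1 + cdist d'.1.1 d'.2.1 <=
      D.+1 + cdist d.2.1 d'.2.1 + (d'.1.2 + d'.2.2) ->
  rstep D d d'.
Proof. by rewrite /rstep /gap; lia. Qed.

(** Delays are excluded here; they serve only when both sides are even. *)
Definition good_domino (a b : nat) (d : domino) : bool :=
  [&& dom a b d, din_grid a b d, tight a b d.1 d.2, d.1.2 == 0 & d.2.2 == 0].

Definition good_step (a b : nat) (d d' : domino) : bool :=
  rstep (a + b - 2) d d' && tight a b d.2 d'.1.

Lemma path_tight_dflat a b d L :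
    all (fun d => tight a b d.1 d.2) (d :: L) -> path (fun d d' => tight a b d.2 d'.1) d L ->
  path (tight a b) d.1 (d.2 :: dflat L).
Proof.
elim: L d => [|d' L IH] d; first by case/andP=> t _ _; rewrite /= t.
case/andP=> t gL /andP[t' pL].
by have := IH _ gL pL; rewrite /= t t'.
Qed.

Lemma good_dominoes a b d L :
    2 < a + b -> all (good_domino a b) (d :: L) -> path (good_step a b) d L ->
  [/\ radio_seq (a + b - 2) d.1 (d.2 :: dflat L), path (tight a b) d.1 (d.2 :: dflat L)
    & all (fun v => v.2 == 0) (d.1 :: d.2 :: dflat L)].
Proof.
move=> ab gL pL; split; last 1 first.
- rewrite -[_ :: _ :: _]/(dflat (d :: L)).
  elim: (d :: L) gL => [//|d' s IH] /andP[/and5P[_ _ _ e1 e2] /IH].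
  by rewrite /dflat /= e1 e2.
- apply: radio_seq_dflat => //.
  + by apply: sub_all gL => d' /and5P[].
  + by apply: sub_all gL => d' /and5P[].
  + by apply: sub_path pL => d1 d2; case/andP.
apply: path_tight_dflat; first by apply: sub_all gL => d' /and5P[].
by apply: sub_path pL => d1 d2 /andP[].
Qed.

Definition pair_stop (x y x' y' : nat) : domino := (zstop (x, y), zstop (x', y')).

Lemma good_pair a b x y x' y' : x < a -> y < b -> x' < a -> y' < b ->
    straddle a x x' -> straddle b y y' -> 2 * (axd x x' + axd y y') <= a + b + 1 ->
  good_domino a b (pair_stop x y x' y').
Proof.
move=> xa yb xa' yb' s s'; have := axd_straddle s; have := axd_straddle s'.
have ti : tight a b (zstop (x, y)) (zstop (x', y')).
  by apply: tightI => //=; apply/andP.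
rewrite /good_domino ti /dom /din_grid /in_grid /wt /= xa yb xa' yb' !andbT.
lia.
Qed.

Lemma good_step_pair a b x y x' y' z t z' t' :
    x' < a -> y' < b -> z < a -> t < b ->
    straddle a x' z -> straddle b y' t ->
    axd x x' + axd x' z + (axd y y' + axd y' t) <= a + b - 1 + axd x z + axd y t ->
    axd x' z + axd z z' + (axd y' t + axd t t') <= a + b - 1 + axd x' z' + axd y' t' ->
  good_step a b (pair_stop x y x' y') (pair_stop z t z' t').
Proof.
move=> xa yb za tb s s' h1 h2; apply/andP; split; last first.
  by apply: tightI => //=; apply/andP.
by apply: rstepI; rewrite /cdist /=; lia.
Qed.

(** * Upper bound for an even and an odd side *)

Section EvenOdd.
Variables h k : nat.

(** The low dominoes join the lower left block to the upper right one, and each of these contains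
    its half of the middle row. The dominoes of [eo_up] join the two remaining blocks. *)
Definition eo_low (x y : nat) : domino := pair_stop x y (h + x) (y + k).
Definition eo_up (x y : nat) : domino := pair_stop x y (h + x) (y - k.+1).

Lemma eo_low_good x y : x < h -> y <= k ->
  good_domino (2 * h) (2 * k).+1 (eo_low x y).
Proof. by move=> xh yk; apply: good_pair; rewrite /straddle /axd; lia. Qed.

Lemma eo_up_good x y : x < h -> k < y -> y <= 2 * k ->
  good_domino (2 * h) (2 * k).+1 (eo_up x y).
Proof. by move=> xh yk yk'; apply: good_pair; rewrite /straddle /axd; lia. Qed.

Lemma eo_low_step x y x' y' : x < h -> y <= k -> x' < h -> y' <= k ->
  good_step (2 * h) (2 * k).+1 (eo_low x y) (eo_low x' y').
Proof.
by move=> xh yk xh' yk'; apply: good_step_pair; rewrite /straddle /axd; lia.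
Qed.

Lemma eo_up_step x y x' y' : x < h -> k < y -> y <= 2 * k -> x' < h -> k < y' -> y' <= 2 * k ->
    (x < x') || (y' < y) ->
  good_step (2 * h) (2 * k).+1 (eo_up x y) (eo_up x' y').
Proof.
by move=> xh yk ? xh' yk' ? ?; apply: good_step_pair; rewrite /straddle /axd; lia.
Qed.

Lemma eo_low_up x x' : 0 < k -> x < h -> x' < h ->
  good_step (2 * h) (2 * k).+1 (eo_low x 0) (eo_up x' (2 * k)).
Proof.
by move=> k0 xh xh'; apply: good_step_pair; rewrite /straddle /axd; lia.
Qed.

Lemma eo_up_low x x' : 0 < k -> x < h -> x' < h -> x != x' ->
  good_step (2 * h) (2 * k).+1 (eo_up x k.+1) (eo_low x' k).
Proof.
by move=> k0 xh xh' ne; apply: good_step_pair; rewrite /straddle /axd; lia.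
Qed.

End EvenOdd.

Lemma rn_dominoes a b z (L : seq domino) : 2 < a + b -> 0 < a -> 0 < b -> 0 < size L ->
    all (good_domino a b) L -> sorted (good_step a b) L ->
    (forall x y, x < a -> y < b -> (x, y) \in map fst (dflat L)) -> 2 * size L = a * b ->
  2 * rn (grid a b) + 2 * wt_sum a b <=
  2 * ((a + b - 2).+1 * (a * b).-1) + wt a b (head z L).1.1 + wt a b (last z L).2.1.
Proof.
case: L => [//|d L] ab a_gt0 b_gt0 _ gL sL cover sz.
have [rs pt e0] := good_dominoes ab gL sL.
have := @rn_grid_tight a b d.1 (d.2 :: dflat L) a_gt0 b_gt0 cover.
rewrite -sz -size_dflat => /(_ erefl rs pt).
have {}e0 : all (fun v : stop => v.2 == 0) (d.2 :: dflat L) by case/andP: e0.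
move=> /(_ e0) /=.
suff -> : last d.2 (dflat L) = (last d L).2 by [].
by elim: L d {gL sL cover sz rs pt e0} => //= d' L IH d; rewrite /dflat /= -/(dflat L) IH.
Qed.

Lemma all_map_cells (P : pred domino) (N : point -> domino) x0 m y0 n :
  (forall x y, x0 <= x < x0 + m -> y0 <= y < y0 + n -> P (N (x, y))) ->
  all P (map N (cells x0 m y0 n)).
Proof.
by move=> H; rewrite all_map; apply/allP => -[x y]; rewrite mem_cells => /andP[]; apply: H.
Qed.

Lemma sorted_cells (R : rel domino) (N : point -> domino) x0 m y0 n :
  (forall x y x' y', x0 <= x < x0 + m -> y0 <= y < y0 + n ->
     x0 <= x' < x0 + m -> y0 <= y' < y0 + n ->
     (x < x') || (x == x') && (y < y') -> R (N (x, y)) (N (x', y'))) ->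
  sorted R (map N (cells x0 m y0 n)).
Proof.
move=> H; apply: sorted_map_cells (pairwise_cells _ _ _ _) _.
by move=> [x y] [x' y']; rewrite !mem_cells => /andP[h1 h2] /andP[h3 h4] /H; apply.
Qed.

Lemma mem_dflat_cells (N : point -> domino) x0 m y0 n x y z :
    x0 <= x < x0 + m -> y0 <= y < y0 + n ->
    (z == (N (x, y)).1.1) || (z == (N (x, y)).2.1) ->
  z \in map fst (dflat (map N (cells x0 m y0 n))).
Proof.
by move=> hx hy; apply: mem_dflat; apply: map_f; rewrite mem_cells hx hy.
Qed.

Lemma last_map_cells (N : point -> domino) z x0 m y0 n : 0 < m -> 0 < n ->
  last z (map N (cells x0 m y0 n)) = N (x0 + m.-1, y0 + n.-1).
Proof.
move=> m0 n0; have : 0 < size (cells x0 m y0 n) by rewrite size_cells muln_gt0 m0.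
by have := last_cells (0, 0) x0 y0 m0 n0; case: (cells _ _ _ _) => //= c s <- _; rewrite last_map.
Qed.

Lemma head_map_cells (N : point -> domino) z x0 m y0 n : 0 < m -> 0 < n ->
  head z (map N (cells x0 m y0 n)) = N (x0, y0).
Proof. by case: m n => [//|m] [|n]. Qed.

Lemma head_cat (T : Type) (z : T) s t : 0 < size s -> head z (s ++ t) = head z s.
Proof. by case: s. Qed.

Lemma mem_dflat_catl s t x : x \in map fst (dflat s) -> x \in map fst (dflat (s ++ t)).
Proof. by rewrite dflat_cat map_cat mem_cat => ->. Qed.

Lemma mem_dflat_catr s t x : x \in map fst (dflat t) -> x \in map fst (dflat (s ++ t)).
Proof. by rewrite dflat_cat map_cat mem_cat orbC => ->. Qed.

(** The ends must be the two central vertices [(h.-1, k)] and [(h, k)], of weight 1, and both belong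
    to low dominoes. Hence the low dominoes are split: those with [x = h.-1] come before all the
    upper ones, the others after. *)
Lemma rn_upper_eo h k : 1 < h -> 0 < k ->
  let a := 2 * h in let b := (2 * k).+1 in
  2 * rn (grid a b) + 2 * wt_sum a b <= 2 * ((a + b - 2).+1 * (a * b).-1) + 2.
Proof.
move=> h1 k0; set a := 2 * h; set b := (2 * k).+1; cbv zeta.
pose lo (u : point) := eo_low h k (h.-1 - u.1) (k - u.2).
pose up (u : point) := eo_up h k u.1 (2 * k - u.2).
pose L1 := map lo (cells 0 1 0 k.+1).
pose L2 := map up (cells 0 h 0 k).
pose L3 := map lo (cells 1 h.-1 0 k.+1).
have h0 : 0 < h by lia. have h0' : 0 < h.-1 by lia.
pose z := pair_stop 0 0 0 0.
have W0 : wt a b (head z (L1 ++ L2 ++ L3)).1.1 = 1.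
  by rewrite /wt /axw /axd /a /b /=; lia.
have W1 : wt a b (last z (L1 ++ L2 ++ L3)).2.1 = 1.
  rewrite catA last_cat last_map_cells //.
  by rewrite /wt /axw /axd /a /b /=; lia.
have := @rn_dominoes a b z (L1 ++ L2 ++ L3).
rewrite W0 W1 -addnA; apply.
- by rewrite /a /b; lia.
- by rewrite /a; lia.
- by [].
- by [].
- rewrite !all_cat; apply/and3P; split; apply: all_map_cells => x y hx hy.
  + by apply: eo_low_good; rewrite /=; lia.
  + by apply: eo_up_good; rewrite /=; lia.
  + by apply: eo_low_good; rewrite /=; lia.
- apply: (sorted_cat (z := z)).
  + by apply: sorted_cells => x y x' y' *; apply: eo_low_step; rewrite /=; lia.
  + apply: (sorted_cat (z := z)).
    * by apply: sorted_cells => x y x' y' *; apply: eo_up_step; rewrite /=; lia.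
    * by apply: sorted_cells => x y x' y' *; apply: eo_low_step; rewrite /=; lia.
    * by rewrite size_map size_cells muln_gt0 h0.
    * by rewrite size_map size_cells muln_gt0 h0'.
    rewrite last_map_cells // head_map_cells // /up /lo /=.
    have -> : 2 * k - (0 + k.-1) = k.+1 by lia.
    by rewrite subn0; apply: eo_up_low; lia.
  + by rewrite size_map size_cells.
  + by rewrite size_cat size_map size_cells addn_gt0 muln_gt0 h0 k0.
  rewrite last_map_cells //.
  rewrite head_cat ?size_map ?size_cells ?muln_gt0 ?h0 // head_map_cells //.
  rewrite /up /lo /= add0n subnn !subn0; apply: eo_low_up; lia.
- move=> x y xa yb.
  case: (ltnP x h) => xh; [case: (leqP y k) => yk | case: (leqP k y) => yk].
  + case: (eqVneq x h.-1) => xe.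
      apply: mem_dflat_catl; apply: (@mem_dflat_cells lo 0 1 0 k.+1 0 (k - y)); try lia.
      by apply/orP; left; rewrite -pair_eqE /pair_eq /=; lia.
    do 2!apply: mem_dflat_catr.
    apply: (@mem_dflat_cells lo 1 h.-1 0 k.+1 (h.-1 - x) (k - y)); try lia.
    by apply/orP; left; rewrite -pair_eqE /pair_eq /=; lia.
  + apply: mem_dflat_catr; apply: mem_dflat_catl.
    apply: (@mem_dflat_cells up 0 h 0 k x (2 * k - y)); try lia.
    by apply/orP; left; rewrite -pair_eqE /pair_eq /=; lia.
  + case: (eqVneq x (2 * h).-1) => xe.
      apply: mem_dflat_catl; apply: (@mem_dflat_cells lo 0 1 0 k.+1 0 (2 * k - y)); try lia.
      by apply/orP; right; rewrite -pair_eqE /pair_eq /=; lia.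
    do 2!apply: mem_dflat_catr.
    apply: (@mem_dflat_cells lo 1 h.-1 0 k.+1 ((2 * h).-1 - x) (2 * k - y)); try lia.
    by apply/orP; right; rewrite -pair_eqE /pair_eq /=; lia.
  apply: mem_dflat_catr; apply: mem_dflat_catl.
  apply: (@mem_dflat_cells up 0 h 0 k (x - h) (k.-1 - y)); try lia.
  by apply/orP; right; rewrite -pair_eqE /pair_eq /=; lia.
rewrite !size_cat !size_map !size_cells /a /b; nia.
Qed.

(** * Upper bound for two odd sides *)

Lemma rn_dominoes_center h k z (L : seq domino) : let a := (2 * h).+1 in let b := (2 * k).+1 in
    0 < h -> 0 < size L ->
    all (good_domino a b) L -> sorted (good_step a b) L ->
    (forall x y, x < a -> y < b -> ((x, y) == (h, k)) || ((x, y) \in map fst (dflat L))) ->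
    (2 * size L).+1 = a * b ->
  2 * rn (grid a b) + 2 * wt_sum a b <=
  2 * ((a + b - 2).+1 * (a * b).-1) + wt a b (last z L).2.1.
Proof.
case: L => [//|d L] a b h0 _ gL sL cover sz.
have ab : 2 < a + b by rewrite /a /b; lia.
have [rs pt e0] := good_dominoes ab gL sL.
(* The number of vertices is odd, so the centre stands alone in front of the dominoes. Its weight is
   0 and it is tight with every vertex. *)
pose c := zstop (h, k).
have wc : wt a b c.1 = 0 by rewrite /wt /axw /axd /a /b /=; lia.
have gc v : in_grid a b v -> tight a b c v.
  case/andP=> h1 h2; apply: tightI => //; rewrite /straddle /in_grid /= /a /b; lia.
case/andP: (gL) => /and5P[d1 /andP[d2 d2'] /andP[/eqP d3 _] /eqP e1 /eqP e2] gL'.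
have tc := gc _ d2.
have rc : radio_seq (a + b - 2) c [:: d.1, d.2 & dflat L].
  rewrite radio_seq_cons2 rs andbT; apply/andP; split.
    have tc' := gc _ d2'; case/andP: tc tc' => /eqP E1 _ /andP[/eqP E2 _].
    case/andP: d2 => h1 h2; have := wt_corner h1 h2.
    by move: E1 E2 d3; rewrite /gap wc; lia.
  case: L gL' {gL sL cover sz rs pt e0} => [//|d' L] /andP[/and5P[_ /andP[/andP[h1 h2] _] _ _ _] _].
  have := wt_corner h1 h2; move: d1; rewrite /dom /dflat /= => d1 d4.
  by apply: three_gaps; rewrite wc; lia.
have := @rn_grid_tight a b c (d.1 :: d.2 :: dflat L) isT isT.
have -> : last c (d.1 :: d.2 :: dflat L) = (last z (d :: L)).2.
  elim: L d {gL sL cover sz rs pt e0 d1 d2 d2' d3 e1 e2 gL' tc rc} => [//|d' L IH] d.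
  by rewrite -[LHS]/(last c (d'.1 :: d'.2 :: dflat L)) IH.
rewrite wc addn0; apply => //.
  by rewrite -[RHS]sz -size_dflat.
by rewrite /= tc.
Qed.

Section OddOdd.
Variables h k : nat.
Local Notation a := (2 * h).+1.
Local Notation b := (2 * k).+1.

(** The four blocks form a pinwheel around the centre: those of [oo_a] contain the two halves of the
    middle row, those of [oo_b] the two halves of the middle column. [oo_a'] traverses the dominoes
    of [oo_a] backwards. *)
Definition oo_a (u : point) : domino := pair_stop u.1 u.2 (h.+1 + u.1) (u.2 + k).
Definition oo_a' (u : point) : domino := pair_stop (h.+1 + u.1) (u.2 + k) u.1 u.2.
Definition oo_b (u : point) : domino := pair_stop (h - u.1 + h) u.2 (h - u.1) (k.+1 + u.2).

Lemma oo_a_good u : u.1 < h -> u.2 <= k -> good_domino a b (oo_a u).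
Proof. by move=> uh uk; apply: good_pair; rewrite /straddle /axd; lia. Qed.

Lemma oo_a'_good u : u.1 < h -> u.2 <= k -> good_domino a b (oo_a' u).
Proof. by move=> uh uk; apply: good_pair; rewrite /straddle /axd; lia. Qed.

Lemma oo_b_good u : u.1 <= h -> u.2 < k -> good_domino a b (oo_b u).
Proof. by move=> uh uk; apply: good_pair; rewrite /straddle /axd; lia. Qed.

Lemma oo_a_step x y x' y' : x < h -> y <= k -> x' < h -> y' <= k ->
  (x < x') || (y < y') -> good_step a b (oo_a (x, y)) (oo_a (x', y')).
Proof. by move=> *; apply: good_step_pair; rewrite /= /straddle /axd; lia. Qed.

Lemma oo_a'_step x y x' y' : x < h -> y <= k -> x' < h -> y' <= k ->
  (x' < x) || (y' < y) -> good_step a b (oo_a' (x, y)) (oo_a' (x', y')).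
Proof. by move=> *; apply: good_step_pair; rewrite /= /straddle /axd; lia. Qed.

Lemma oo_b_step x y x' y' : x <= h -> y < k -> x' <= h -> y' < k ->
  (x < x') || (y < y') -> good_step a b (oo_b (x, y)) (oo_b (x', y')).
Proof. by move=> *; apply: good_step_pair; rewrite /= /straddle /axd; lia. Qed.

Lemma oo_a_b : 0 < h -> 0 < k -> good_step a b (oo_a (h.-1, k)) (oo_b (h, 0)).
Proof. by move=> *; apply: good_step_pair; rewrite /= /straddle /axd; lia. Qed.

Lemma oo_a'_b x x' y : 0 < k -> x < h -> x' <= h -> y < k ->
  good_step a b (oo_a' (x, k)) (oo_b (x', y)).
Proof. by move=> *; apply: good_step_pair; rewrite /= /straddle /axd; lia. Qed.

Lemma oo_b_a' x y x' : x <= h -> y < k -> x' < h ->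
  good_step a b (oo_b (x, y)) (oo_a' (x', 0)).
Proof. by move=> *; apply: good_step_pair; rewrite /= /straddle /axd; lia. Qed.

End OddOdd.

Lemma pairwise_cat_lt (s t : seq point) n : pairwise lexlt s -> pairwise lexlt t ->
    all (fun u => u.1 < n) s -> all (fun u => n <= u.1) t ->
  pairwise lexlt (s ++ t).
Proof.
move=> ps pt /allP sn /allP tn; rewrite pairwise_cat ps pt !andbT.
by apply/allrelP => u v /sn un /tn vn; rewrite /lexlt (leq_trans un vn).
Qed.

Section OddOddList.
Variables h k : nat.
Hypotheses (h3 : 2 < h) (k0 : 0 < k).
Local Notation a := (2 * h).+1.
Local Notation b := (2 * k).+1.

(* The cells (1,0), (0,k), (2,0), (1,k) are set aside for the passages between segments. *)
Definition oo_cells_a : seq point :=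
  cells 0 1 0 k ++ cells 1 1 1 k.-1 ++ cells 2 1 1 k ++ cells 3 (h - 3) 0 k.+1.
Definition oo_cells_b : seq point := cells 0 1 1 k.-1 ++ cells 1 h.-1 0 k.

(** A passage between two segments of [oo_b] enters and leaves through the middle row: [oo_a']
    starts on it at ordinate 0 and ends on it at ordinate [k]. The last vertex is [(h, k.+1)], of
    weight 2. The cell [(2, 0)] is what requires [2 < h]. *)
Definition oo_list : seq domino :=
  map (oo_a h k) oo_cells_a ++ map (oo_b h k) (cells h 1 0 k) ++
  [:: oo_a' h k (1, 0); oo_a' h k (0, k)] ++ map (oo_b h k) oo_cells_b ++
  [:: oo_a' h k (2, 0); oo_a' h k (1, k); oo_b h k (0, 0)].

Lemma mem_oo_cells_a x y : (x, y) \in oo_cells_a =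
  [&& x < h, y <= k & (x, y) \notin [:: (1, 0); (0, k); (2, 0); (1, k)]].
Proof.
rewrite /oo_cells_a mem_cat mem_cells mem_cat mem_cells mem_cat !mem_cells !inE.
by rewrite -!pair_eqE /pair_eq /=; lia.
Qed.

Lemma mem_oo_cells_b x y : (x, y) \in oo_cells_b = [&& x < h, y < k & (x, y) != (0, 0)].
Proof. by rewrite /oo_cells_b mem_cat mem_cells !mem_cells -!pair_eqE /pair_eq /=; lia. Qed.

Lemma all_cells (P : pred point) x0 m y0 n :
  (forall x y, x0 <= x < x0 + m -> y0 <= y < y0 + n -> P (x, y)) -> all P (cells x0 m y0 n).
Proof. by move=> H; apply/allP => -[x y]; rewrite mem_cells => /andP[]; apply: H. Qed.

Lemma pairwise_oo_cells_a : pairwise lexlt oo_cells_a.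
Proof.
have P := pairwise_cells.
apply: (@pairwise_cat_lt _ _ 1); [exact: P | | by apply: all_cells => x y /=; lia |].
  apply: (@pairwise_cat_lt _ _ 2); [exact: P | | by apply: all_cells => x y /=; lia |].
    by apply: (@pairwise_cat_lt _ _ 3); [exact: P | exact: P | |]; apply: all_cells => x y /=; lia.
  by apply/allP => -[x y]; rewrite mem_cat !mem_cells /=; lia.
by apply/allP => -[x y]; rewrite mem_cat mem_cells mem_cat !mem_cells /=; lia.
Qed.

Lemma pairwise_oo_cells_b : pairwise lexlt oo_cells_b.
Proof.
by apply: (@pairwise_cat_lt _ _ 1); try exact: pairwise_cells; apply: all_cells => x y /=; lia.
Qed.

Lemma size_oo_list : 2 * size oo_list + 1 = a * b.
Proof.
rewrite /oo_list /oo_cells_a /oo_cells_b !size_cat !size_map !size_cat !size_cells /=.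
have [h' ->] : exists h', h = h' + 3 by exists (h - 3); lia.
have [k' ->] : exists k', k = k'.+1 by exists k.-1; lia.
have -> : h' + 3 - 3 = h' by lia.
have -> : (h' + 3).-1 = h' + 2 by lia.
rewrite !(size_map, size_iota) [k'.+1.-1]/=; nia.
Qed.

Lemma oo_list_a x y : x < h -> y <= k ->
  (oo_a h k (x, y) \in oo_list) || (oo_a' h k (x, y) \in oo_list).
Proof.
move=> xh yk; rewrite /oo_list !mem_cat.
case: (boolP ((x, y) \in oo_cells_a)) => [/(map_f (oo_a h k))-> //|].
rewrite mem_oo_cells_a xh yk !andTb negbK !inE => /or4P[]/eqP->;
  by rewrite !eqxx ?orbT.
Qed.

Lemma oo_list_b x y : x <= h -> y < k -> oo_b h k (x, y) \in oo_list.
Proof.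
move=> xh yk; rewrite /oo_list !mem_cat.
case: (boolP ((x, y) \in oo_cells_b)) => [/(map_f (oo_b h k))->|]; first by rewrite ?orbT.
rewrite mem_oo_cells_b yk andTb; case: (ltnP x h) => [_ /= | hx _].
  by rewrite negbK => /eqP->; rewrite !inE !eqxx ?orbT.
have -> : oo_b h k (x, y) \in map (oo_b h k) (cells h 1 0 k); last by rewrite ?orbT.
by apply: map_f; rewrite mem_cells; lia.
Qed.

Lemma all_oo_list : all (good_domino a b) oo_list.
Proof.
rewrite /oo_list; apply/allP => d; rewrite !mem_cat => /or4P[||| /orP[]].
- case/mapP => -[x y]; rewrite mem_oo_cells_a => /and3P[xh yk _] ->.
  exact: oo_a_good.
- by case/mapP => -[x y]; rewrite mem_cells => /andP[h1 h2] ->; apply: oo_b_good; rewrite /=; lia.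
- by rewrite !inE => /orP[]/eqP->; apply: oo_a'_good; rewrite /=; lia.
- case/mapP => -[x y]; rewrite mem_oo_cells_b => /and3P[xh yk _] ->.
  by apply: oo_b_good; rewrite /= // ltnW.
rewrite !inE => /or3P[]/eqP->; first [apply: oo_a'_good | apply: oo_b_good];
  by rewrite /=; lia.
Qed.

Lemma last_oo_cells_a : last (0, 0) oo_cells_a = (h.-1, k).
Proof.
(* For [h = 3] the last block is empty, and the block with first coordinate 2 ends the list
   instead. *)
rewrite /oo_cells_a 3!last_cat; case: (ltnP 3 h) => h4.
  by rewrite last_cells; [congr pair; lia | lia | ].
have -> : h - 3 = 0 by lia.
by rewrite -[cells 3 0 0 k.+1]/[::] /= last_cells //; congr pair; lia.
Qed.

Lemma sorted_oo_list : sorted (good_step a b) oo_list.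
Proof.
pose z := oo_a h k (0, 0).
have s0 : 0 < size oo_cells_a by rewrite /oo_cells_a size_cat size_cells; lia.
have s1 : 0 < size oo_cells_b by rewrite /oo_cells_b size_cat !size_cells; nia.
apply: (sorted_cat (z := z)).
- apply: sorted_map_cells pairwise_oo_cells_a _ => -[x y] [x' y'].
  rewrite !mem_oo_cells_a => /and3P[xh yk _] /and3P[xh' yk' _] lt.
  by apply: oo_a_step => //; move: lt; rewrite /lexlt /=; lia.
- apply: (sorted_cat (z := z)).
  + by apply: sorted_cells => *; apply: oo_b_step; lia.
  + apply: (sorted_cat (z := z)) => //.
    * by rewrite /= andbT; apply: oo_a'_step; lia.
    * apply: (sorted_cat (z := z)).
      - apply: sorted_map_cells pairwise_oo_cells_b _ => -[x y] [x' y'].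
        rewrite !mem_oo_cells_b => /and3P[xh yk _] /and3P[xh' yk' _] lt.
        by apply: oo_b_step => //; move: lt; rewrite /lexlt /=; lia.
      - by rewrite /= andbT; apply/andP; split; [apply: oo_a'_step | apply: oo_a'_b]; lia.
      - by rewrite size_map.
      - by [].
      have -> : last z (map (oo_b h k) oo_cells_b) = oo_b h k (1 + h.-1.-1, 0 + k.-1).
        by rewrite /oo_cells_b map_cat last_cat last_map_cells //; lia.
      by apply: oo_b_a'; lia.
    * by rewrite size_cat size_map ltn_addr.
    * rewrite head_cat ?size_map // /=.
      case E: oo_cells_b s1 => [//|[x y] s] _ /=.
      have : (x, y) \in oo_cells_b by rewrite E inE eqxx.
      by rewrite mem_oo_cells_b => /and3P[xh yk _]; apply: oo_a'_b; lia.
  + by rewrite size_map size_cells mul1n.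
  + by [].
  rewrite last_map_cells // head_cat //=.
  by apply: oo_b_a'; lia.
- by rewrite size_map.
- by rewrite size_cat size_map size_cells; lia.
have -> : last z (map (oo_a h k) oo_cells_a) = oo_a h k (h.-1, k).
  by rewrite -last_oo_cells_a last_map.
rewrite head_cat ?size_map ?size_cells ?mul1n // head_map_cells //.
by apply: oo_a_b; lia.
Qed.

Lemma rn_upper_oo :
  2 * rn (grid a b) + 2 * wt_sum a b <= 2 * ((a + b - 2).+1 * (a * b).-1) + 2.
Proof.
have W : wt a b (last (oo_a h k (0, 0)) oo_list).2.1 = 2.
  by rewrite /oo_list !last_cat /= /wt /axw /axd /=; lia.
have := @rn_dominoes_center h k (oo_a h k (0, 0)) oo_list.
cbv zeta; rewrite W; apply.
- by lia.
- by have := size_oo_list; case: oo_list => //=; lia.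
- exact: all_oo_list.
- exact: sorted_oo_list.
- move=> x y xa yb; case: (eqVneq (x, y) (h, k)) => [//|]; rewrite -pair_eqE /pair_eq /= => ne.
  have inA x' y' : x' < h -> y' <= k ->
      ((x, y) == (x', y')) || ((x, y) == (h.+1 + x', y' + k)) ->
      (x, y) \in map fst (dflat oo_list).
    move=> xh yk H; case/orP: (oo_list_a xh yk) => /mem_dflat; apply => //=.
    by rewrite orbC.
  have inB x' y' : x' <= h -> y' < k ->
      ((x, y) == (h - x' + h, y')) || ((x, y) == (h - x', k.+1 + y')) ->
      (x, y) \in map fst (dflat oo_list).
    by move=> xh yk H; apply: mem_dflat (oo_list_b xh yk) _.
  case: (ltnP x h) => xh; case: (leqP y k) => yk.
  + by apply: (inA x y) => //; rewrite eqxx.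
  + by apply: (inB (h - x) (y - k.+1)); rewrite -?pair_eqE /pair_eq /=; lia.
  + case: (ltnP y k) => yk'.
      by apply: (inB (2 * h - x) y); rewrite -?pair_eqE /pair_eq /=; lia.
    by apply: (inA (x - h.+1) (y - k)); rewrite -?pair_eqE /pair_eq /=; lia.
  case: (eqVneq x h) => xe.
    by apply: (inB 0 (y - k.+1)); rewrite -?pair_eqE /pair_eq /=; lia.
  by apply: (inA (x - h.+1) (y - k)); rewrite -?pair_eqE /pair_eq /=; lia.
by rewrite -addn1 size_oo_list.
Qed.

End OddOddList.

(** * Upper bound for two even sides *)

Section EvenEven.
Variables h k : nat.
Hypotheses (h1 : 1 < h) (k1 : 1 < k).
Local Notation a := (2 * h).
Local Notation b := (2 * k).

Definition ee_dom (e x y x' y' : nat) : domino := (((x, y), e), zstop (x', y')).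

(* The extra unit is the loss forced at one corner of each diagonal class. *)
Definition ee_n (u : point) : domino :=
  ee_dom (u == (0, 0)) u.1 u.2 (h + u.1) (k + u.2).
Definition ee_m (u : point) : domino :=
  ee_dom (u == (h.-1, k.-1)) (h + u.1) (k.-1 - u.2) u.1 (b.-1 - u.2).

Definition ee_ok (d : domino) : bool := [&& dom a b d, din_grid a b d & tight a b d.1 d.2].

Lemma ee_ok_dom e x y x' y' : x < a -> y < b -> x' < a -> y' < b ->
    straddle a x x' -> straddle b y y' -> axd x x' + axd y y' <= h + k ->
  ee_ok (ee_dom e x y x' y').
Proof.
move=> xa yb xa' yb' s s'; have := axd_straddle s; have := axd_straddle s'.
have ti : tight a b ((x, y), e) (zstop (x', y')).
  by apply: tightI => //=; apply/andP.
rewrite /ee_ok ti /dom /din_grid /in_grid /wt /= xa yb xa' yb' !andbT.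
lia.
Qed.

Lemma ee_step_dom e x y x' y' e' z t z' t' :
    x' < a -> y' < b -> z < a -> t < b ->
    straddle a x' z -> straddle b y' t ->
    axd x x' + axd x' z + (axd y y' + axd y' t) <= a + b - 1 + axd x z + axd y t + e' ->
    axd x' z + axd z z' + (axd y' t + axd t t') <= a + b - 1 + axd x' z' + axd y' t' + e' ->
  good_step a b (ee_dom e x y x' y') (ee_dom e' z t z' t').
Proof.
move=> xa yb za tb s s' H1 H2; apply/andP; split; last first.
  by apply: tightI => //=; apply/andP.
by apply: rstepI; rewrite /cdist /=; lia.
Qed.

Lemma ee_n_ok x y : x < h -> y < k -> ee_ok (ee_n (x, y)).
Proof. by move=> *; apply: ee_ok_dom; rewrite /= /straddle /axd; lia. Qed.

Lemma ee_m_ok x y : x < h -> y < k -> ee_ok (ee_m (x, y)).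
Proof. by move=> *; apply: ee_ok_dom; rewrite /= /straddle /axd; lia. Qed.

Lemma ee_n_step x y x' y' : x < h -> y < k -> x' < h -> y' < k ->
  (x < x') || (y < y') -> good_step a b (ee_n (x, y)) (ee_n (x', y')).
Proof. by move=> *; apply: ee_step_dom; rewrite /= /straddle /axd; lia. Qed.

Lemma ee_m_dist x y x' y' : x < h -> y < k -> x' < h -> y' < k ->
  [/\ axd (h + x) x = h, axd (k.-1 - y) (b.-1 - y) = k,
      axd x (h + x') = h + x' - x & axd (b.-1 - y) (k.-1 - y') = k + y' - y] /\
  [/\ axd (h + x) (h + x') = axd x x', axd (k.-1 - y) (k.-1 - y') = axd y y'
    & axd (b.-1 - y) (b.-1 - y') = axd y y'].
Proof. by move=> *; do !split; rewrite /axd; lia. Qed.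

Lemma ee_m_step x y x' y' : x < h -> y < k -> x' < h -> y' < k ->
  (x' < x) || (y' < y) -> good_step a b (ee_m (x, y)) (ee_m (x', y')).
Proof.
move=> xh yk xh' yk' lt; have [[D1 D2 D3 D4] [D5 D6 D7]] := ee_m_dist xh yk xh' yk'.
have [[D1' D2' _ _] _] := ee_m_dist xh' yk' xh yk.
apply: ee_step_dom; rewrite /= ?D1 ?D2 ?D3 ?D4 ?D5 ?D6 ?D7 ?D1' ?D2' /straddle; try lia;
  by rewrite /axd; lia.
Qed.

(** The two corners of the class become consecutive here. Both windows of three around them miss the
    bound by exactly 1, so a single delay repairs the two. *)
Lemma ee_n_start : good_step a b (ee_n (h.-1, k.-1)) (ee_n (0, 0)).
Proof. by rewrite /ee_n eqxx; apply: ee_step_dom; rewrite /= /straddle /axd; lia. Qed.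

Lemma ee_m_end : good_step a b (ee_m (0, 0)) (ee_m (h.-1, k.-1)).
Proof.
have [x0 y0 x1 y1] : [/\ 0 < h, 0 < k, h.-1 < h & k.-1 < k] by split; lia.
have [[D1 D2 D3 D4] [D5 D6 D7]] := ee_m_dist x0 y0 x1 y1.
have [[D1' D2' _ _] _] := ee_m_dist x1 y1 x0 y0.
rewrite /ee_m eqxx; apply: ee_step_dom;
  rewrite /= ?D1 ?D2 ?D3 ?D4 ?D5 ?D6 ?D7 ?D1' ?D2' /straddle; try lia;
  by rewrite /axd; lia.
Qed.

(** The passage between the diagonal classes runs inside the column [h], next to the centre line. It
    is not tight, but its loss is only 2. *)
Lemma ee_switch : rstep (a + b - 2) (ee_n (0, k.-1)) (ee_m (0, k.-1)).
Proof. by apply: rstepI; rewrite /cdist /axd /=; lia. Qed.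

(** Two cells are kept apart to begin and end the halves: [(h.-1, k.-1)] opens the first and closes
    the second, which puts the ends of the list next to the centre; [(0, k.-1)] closes the first and
    opens the second, for the switch. *)
Definition ee_cells : seq point := cells 0 1 0 k.-1 ++ cells 1 (h - 2) 0 k ++ cells h.-1 1 0 k.-1.

Lemma mem_ee_cells x y : (x, y) \in ee_cells =
  [&& x < h, y < k, (x, y) != (0, k.-1) & (x, y) != (h.-1, k.-1)].
Proof.
by rewrite /ee_cells mem_cat mem_cells mem_cat !mem_cells -!pair_eqE /pair_eq /=; lia.
Qed.

Lemma pairwise_ee_cells : pairwise lexlt ee_cells.
Proof.
have P := pairwise_cells.
apply: (@pairwise_cat_lt _ _ 1); [exact: P | | by apply: all_cells => x y /=; lia |].
  by apply: (@pairwise_cat_lt _ _ h.-1); [exact: P | exact: P | |];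
    apply: all_cells => x y /=; lia.
by apply/allP => -[x y]; rewrite mem_cat !mem_cells /=; lia.
Qed.

Lemma head_ee_cells z : head z ee_cells = (0, 0).
Proof. by rewrite /ee_cells head_cat ?head_cells ?size_cells //; lia. Qed.

Lemma last_ee_cells z : last z ee_cells = (h.-1, k - 2).
Proof. by rewrite /ee_cells 2!last_cat last_cells //; [congr pair|]; lia. Qed.

Lemma size_ee_cells : size ee_cells + 2 = h * k.
Proof.
rewrite /ee_cells size_cat size_cells size_cat !size_cells.
have [h' ->] : exists h', h = h' + 2 by exists (h - 2); lia.
have [k' ->] : exists k', k = k'.+1 by exists k.-1; lia.
by rewrite addnK /=; nia.
Qed.

Definition ee_half : seq domino := map ee_n ee_cells ++ [:: ee_n (0, k.-1)].
Definition ee_half' : seq domino := map ee_m (rev ee_cells) ++ [:: ee_m (h.-1, k.-1)].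

Lemma size_ee_gt0 : 0 < size ee_cells.
Proof. by have := size_ee_cells; nia. Qed.

Lemma path_ee_half : path (good_step a b) (ee_n (h.-1, k.-1)) ee_half.
Proof.
pose z := ee_n (0, 0).
(* The path is read as a sorted concatenation whose first part is the opening domino alone. *)
apply: (@sorted_cat _ _ z [:: _]) => //; last first.
  rewrite /ee_half head_cat ?size_map ?size_ee_gt0 //=.
  have := head_ee_cells (0, 0); have := size_ee_gt0.
  by case: ee_cells => //= c s _ ->; apply: ee_n_start.
  by rewrite /ee_half size_cat addn1.
apply: (@sorted_cat _ _ z) => //.
- apply: sorted_map_cells pairwise_ee_cells _ => -[x y] [x' y'].
  rewrite !mem_ee_cells => /and3P[xh yk _] /and3P[xh' yk' _] lt.
  by apply: ee_n_step => //; move: lt; rewrite /lexlt /=; lia.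
- by rewrite size_map size_ee_gt0.
have -> : last z (map ee_n ee_cells) = ee_n (h.-1, k - 2).
  by rewrite -(last_ee_cells (0, 0)) last_map.
by apply: ee_n_step; lia.
Qed.

Lemma path_ee_half' : path (good_step a b) (ee_m (0, k.-1)) ee_half'.
Proof.
pose z := ee_m (0, 0).
have s0 : 0 < size (rev ee_cells) by rewrite size_rev size_ee_gt0.
apply: (@sorted_cat _ _ z [:: _]) => //; last first.
  have -> : head z ee_half' = ee_m (h.-1, k - 2).
    rewrite /ee_half' head_cat ?size_map //.
    have := last_ee_cells (0, 0); case/lastP E : ee_cells s0 => [//|s c] _.
    by rewrite last_rcons rev_rcons => <-.
  by apply: ee_m_step; lia.
  by rewrite /ee_half' size_cat addn1.
apply: (@sorted_cat _ _ z) => //.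
- rewrite map_rev rev_sorted; apply: sorted_map_cells pairwise_ee_cells _ => -[x y] [x' y'].
  rewrite !mem_ee_cells => /and3P[xh yk _] /and3P[xh' yk' _] lt.
  by apply: ee_m_step => //; move: lt; rewrite /lexlt /=; lia.
- by rewrite size_map.
have -> : last z (map ee_m (rev ee_cells)) = ee_m (0, 0).
  have := head_ee_cells (0, 0); case: ee_cells s0 => //= c s _ ->.
  by rewrite rev_cons map_rcons last_rcons.
exact: ee_m_end.
Qed.

Lemma all_ee_half : all ee_ok (ee_n (h.-1, k.-1) :: ee_half).
Proof.
rewrite /ee_half /= all_cat !ee_n_ok /=; try lia.
rewrite ee_n_ok ?andbT; try lia.
rewrite all_map; apply/allP => -[x y]; rewrite mem_ee_cells => /and3P[xh yk _].
exact: ee_n_ok.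
Qed.

Lemma all_ee_half' : all ee_ok (ee_m (0, k.-1) :: ee_half').
Proof.
rewrite /ee_half' /= all_cat !ee_m_ok /=; try lia.
rewrite ee_m_ok ?andbT; try lia.
rewrite all_map; apply/allP => -[x y]; rewrite mem_rev mem_ee_cells => /and3P[xh yk _].
exact: ee_m_ok.
Qed.

End EvenEven.

Lemma sum_extra (N : point -> domino) (c : point) s :
    (forall u, (N u).1.2 = (u == c)) -> (forall u, (N u).2.2 = 0) ->
  \sum_(v <- dflat (map N s)) v.2 = count_mem c s.
Proof.
move=> N1 N2; elim: s => [|u s IH]; first by rewrite big_nil.
by rewrite /dflat /= -/(dflat (map N s)) !big_cons IH N1 N2.
Qed.

Lemma count_ee_cells h k c : 1 < h -> 1 < k -> count_mem c (ee_cells h k) <= 1.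
Proof.
move=> h1 k1; rewrite count_uniq_mem ?leq_b1 //.
have irr : irreflexive lexlt by move=> u; rewrite /lexlt eqxx !ltnn.
exact: pairwise_uniq irr (pairwise_ee_cells h1 k1).
Qed.

Lemma ee_cover h k x y : 1 < h -> 1 < k -> x < 2 * h -> y < 2 * k ->
  (x, y) \in map fst (dflat ((ee_n h k (h.-1, k.-1) :: ee_half h k) ++
    (ee_m h k (0, k.-1) :: ee_half' h k))).
Proof.
move=> h1 k1 xa yb.
have inN x' y' : x' < h -> y' < k ->
    ((x, y) == (x', y')) || ((x, y) == (h + x', k + y')) ->
    (x, y) \in map fst (dflat (ee_n h k (h.-1, k.-1) :: ee_half h k)).
  move=> xh yk H; apply: (mem_dflat (d := ee_n h k (x', y'))) H.
  rewrite /ee_half inE mem_cat inE.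
  case: (eqVneq (x', y') (h.-1, k.-1)) => [->|n1]; first by rewrite eqxx.
  case: (eqVneq (x', y') (0, k.-1)) => [->|n2]; first by rewrite eqxx !orbT.
  by rewrite (map_f (ee_n h k)) ?orbT // mem_ee_cells // xh yk n2.
have inM x' y' : x' < h -> y' < k ->
    ((x, y) == (h + x', k.-1 - y')) || ((x, y) == (x', (2 * k).-1 - y')) ->
    (x, y) \in map fst (dflat (ee_m h k (0, k.-1) :: ee_half' h k)).
  move=> xh yk H; apply: (mem_dflat (d := ee_m h k (x', y'))) H.
  rewrite /ee_half' inE mem_cat inE.
  case: (eqVneq (x', y') (h.-1, k.-1)) => [->|n1]; first by rewrite eqxx !orbT.
  case: (eqVneq (x', y') (0, k.-1)) => [->|n2]; first by rewrite eqxx.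
  by rewrite (map_f (ee_m h k)) ?orbT // mem_rev mem_ee_cells // xh yk n2.
case: (ltnP x h) => xh; case: (ltnP y k) => yk.
- by apply/mem_dflat_catl/(inN x y) => //; rewrite eqxx.
- by apply/mem_dflat_catr/(inM x ((2 * k).-1 - y)); rewrite -?pair_eqE /pair_eq /=; lia.
- by apply/mem_dflat_catr/(inM (x - h) (k.-1 - y)); rewrite -?pair_eqE /pair_eq /=; lia.
by apply/mem_dflat_catl/(inN (x - h) (y - k)); rewrite -?pair_eqE /pair_eq /=; lia.
Qed.

(** Each half is tight, so [total_tight] is applied twice and the switch is added by hand. The 10 is
    made of end weights [2 + 2], a loss of 2 at the switch, and two delays counted twice. *)
Lemma rn_upper_ee h k : 1 < h -> 1 < k ->
  2 * rn (grid (2 * h) (2 * k)) + 2 * wt_sum (2 * h) (2 * k) <=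
  2 * ((2 * h + 2 * k - 2).+1 * (2 * h * (2 * k)).-1) + 10.
Proof.
move=> h1 k1; set a := 2 * h; set b := 2 * k; set D := a + b - 2.
pose d := ee_n h k (h.-1, k.-1); pose m := ee_m h k (0, k.-1).
pose L := ee_half h k; pose L' := ee_half' h k.
have cover x y : x < a -> y < b -> (x, y) \in map fst (dflat ((d :: L) ++ (m :: L'))).
  exact: ee_cover.
have okL : all (ee_ok h k) (d :: L) by apply: all_ee_half.
have okL' : all (ee_ok h k) (m :: L') by apply: all_ee_half'.
have pL : path (good_step a b) d L by apply: path_ee_half.
have pL' : path (good_step a b) m L' by apply: path_ee_half'.
have lastL : last d L = ee_n h k (0, k.-1) by rewrite /L /ee_half last_cat.
have lastL' : last m L' = ee_m h k (h.-1, k.-1) by rewrite /L' /ee_half' last_cat.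
have [a_gt0 b_gt0] : 0 < a /\ 0 < b by rewrite /a /b; lia.
have step_radio (d1 d2 : domino) : good_step a b d1 d2 -> rstep D d1 d2 by case/andP.
have step_tight (d1 d2 : domino) : good_step a b d1 d2 -> tight a b d1.2 d2.1 by case/andP.
have ok3 (e : domino) : ee_ok h k e -> tight a b e.1 e.2 by case/and3P.
pose s := d.2 :: dflat L; pose t := m.2 :: dflat L'.
have Est : dflat ((d :: L) ++ (m :: L')) = d.1 :: (s ++ m.1 :: t) by rewrite dflat_cat.
have rs : radio_seq D d.1 (s ++ m.1 :: t).
  have -> : s ++ m.1 :: t = d.2 :: dflat (L ++ m :: L') by rewrite dflat_cat.
  have okall : all (ee_ok h k) (d :: (L ++ m :: L')).
    by rewrite -cat_cons all_cat okL okL'.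
  apply: radio_seq_dflat; first by rewrite /a /b; lia.
  - by apply: sub_all okall => e /and3P[].
  - by apply: sub_all okall => e /and3P[].
  rewrite cat_path lastL /= ee_switch // !(sub_path _ pL) //=.
  exact: sub_path pL'.
have ts : path (tight a b) d.1 s.
  by apply: path_tight_dflat; [apply: sub_all okL | apply: sub_path pL].
have tt' : path (tight a b) m.1 t.
  by apply: path_tight_dflat; [apply: sub_all okL' | apply: sub_path pL'].
have last_dflat e M : last e.2 (dflat M) = (last e M).2.
  by elim: M e => //= e' M IH e; rewrite /dflat /= -/(dflat M) IH.
have cov' x y : x < a -> y < b -> (x, y) \in map fst (d.1 :: (s ++ m.1 :: t)).
  by rewrite -Est; apply: cover.
have := rn_grid_le_total a_gt0 b_gt0 cov' rs.
rewrite total_cat -/D.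
have szL : size L + 1 = h * k.
  by rewrite /L /ee_half size_cat size_map -size_ee_cells //=; lia.
have szL' : size L' + 1 = h * k.
  by rewrite /L' /ee_half' size_cat size_map size_rev -size_ee_cells //=; lia.
have sz : size (d.1 :: (s ++ m.1 :: t)) = a * b.
  by rewrite /= size_cat /= !size_dflat /a /b; nia.
have := sum_wt cov'; rewrite size_map => /(_ sz).
have -> : \sum_(v <- map fst (d.1 :: (s ++ m.1 :: t))) wt a b v = wt a b d.1.1 +
    (\sum_(v <- s) wt a b v.1 + (wt a b m.1.1 + \sum_(v <- t) wt a b v.1)).
  by rewrite big_map big_cons big_cat big_cons.
have := total_tight ts; have := total_tight tt'; rewrite -/D.
have -> : last d.1 s = (ee_n h k (0, k.-1)).2.
  by rewrite -[LHS]/(last d.2 (dflat L)) last_dflat lastL.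
have -> : last m.1 t = (ee_m h k (h.-1, k.-1)).2.
  by rewrite -[LHS]/(last m.2 (dflat L')) last_dflat lastL'.
have Xs : \sum_(v <- s) v.2 <= 1.
  rewrite /s big_cons /= /L /ee_half dflat_cat big_cat /= (sum_extra (c := (0, 0))) //.
  have := count_ee_cells (0, 0) h1 k1.
  rewrite /dflat /= !big_cons big_nil /= -pair_eqE /pair_eq /=; lia.
have Xt : \sum_(v <- t) v.2 <= 1.
  rewrite /t big_cons /= /L' /ee_half' dflat_cat big_cat /= (sum_extra (c := (h.-1, k.-1))) //.
  (* The delayed cell is not in [ee_cells]: the only delay is that of the closing domino. *)
  rewrite count_rev (_ : count_mem _ _ = 0); last first.
    by apply/count_memPn; rewrite mem_ee_cells // eqxx !andbF.
  by rewrite /dflat /= !big_cons big_nil /= eqxx.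
have szs : size s = (2 * size L).+1 by rewrite /= size_dflat.
have szt : size t = (2 * size L').+1 by rewrite /= size_dflat.
have W0 : wt a b d.1.1 = 2 by rewrite /wt /axw /axd /a /b /=; lia.
have W1 : wt a b (ee_n h k (0, k.-1)).2.1 = b by rewrite /wt /axw /axd /a /b /=; lia.
have W2 : wt a b m.1.1 = b by rewrite /wt /axw /axd /a /b /=; lia.
have W3 : wt a b (ee_m h k (h.-1, k.-1)).2.1 = 2 by rewrite /wt /axw /axd /a /b /=; lia.
have G : gap D (ee_n h k (0, k.-1)).2 m.1 = a.
  rewrite /gap /m /ee_m /cdist /axd /= -pair_eqE /pair_eq /= /D /a /b; lia.
rewrite W0 W1 W2 W3 G szs szt.
have n1 : (a * b).-1 = 2 * size L + 2 * size L' + 3.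
  by move: sz; rewrite /= size_cat /= !size_dflat; lia.
have DE : a + b = D + 2 by rewrite /D; lia.
rewrite n1; move: (total_gap _ _ _) (total_gap _ _ _) Xs Xt DE.
move: (\sum_(_ <- _) _) (\sum_(_ <- _) _) (\sum_(_ <- _) _) (\sum_(_ <- _) _) (size L) (size L').
by move: (rn _) (wt_sum a b); clearbody a b D; clear; lia.
Qed.

(** * Small odd grids by explicit lists *)

Lemma rn_upper_table a b l : 0 < a -> 0 < b ->
    let u := head (zstop (0, 0)) (map zstop l) in let s := behead (map zstop l) in
    [&& all (mem l) (gridpts a b), size l == a * b, radio_seq (a + b - 2) u s,
      path (tight a b) u s & wt a b u.1 + wt a b (last u s).1 == 2] ->
  2 * rn (grid a b) + 2 * wt_sum a b <= 2 * ((a + b - 2).+1 * (a * b).-1) + 2.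
Proof.
move=> a_gt0 b_gt0 u s /and5P[/allP cov /eqP sz rs pt /eqP w2].
have l0 : map zstop l = u :: s.
  by rewrite /u /s; case: (l) sz => //= E; have := muln_gt0 a b; rewrite -E a_gt0 b_gt0.
have cover x y : x < a -> y < b -> (x, y) \in map fst (u :: s).
  by move=> xa yb; rewrite -l0 -map_comp map_id; apply: cov; rewrite mem_gridpts xa.
have sz' : size (u :: s) = a * b by rewrite -l0 size_map.
have := rn_grid_tight a_gt0 b_gt0 cover sz' rs pt; rewrite -addnA w2; apply.
by apply/allP => v /mem_behead /mapP[p _ ->].
Qed.

Lemma rn_upper_33 : 2 * rn (grid 3 3) + 2 * wt_sum 3 3 <= 2 * ((3 + 3 - 2).+1 * (3 * 3).-1) + 2.
Proof.
by apply: (@rn_upper_table 3 3 [:: (1, 1); (0, 0); (1, 2); (2, 0); (0, 1); (2, 2); (1, 0); (0, 2);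
  (2, 1)]).
Qed.

Lemma rn_upper_53 : 2 * rn (grid 5 3) + 2 * wt_sum 5 3 <= 2 * ((5 + 3 - 2).+1 * (5 * 3).-1) + 2.
Proof.
by apply: (@rn_upper_table 5 3 [:: (2, 1); (0, 0); (3, 2); (1, 1); (4, 0); (2, 2); (1, 0); (4, 1);
  (0, 2); (2, 0); (4, 2); (0, 1); (3, 0); (1, 2); (3, 1)]).
Qed.

Lemma rn_upper_55 : 2 * rn (grid 5 5) + 2 * wt_sum 5 5 <= 2 * ((5 + 5 - 2).+1 * (5 * 5).-1) + 2.
Proof.
by apply: (@rn_upper_table 5 5 [:: (2, 2); (0, 0); (3, 4); (1, 2); (4, 0); (2, 4); (0, 1); (4, 3);
  (2, 0); (0, 4); (4, 2); (1, 0); (3, 3); (1, 1); (2, 3); (3, 0); (0, 3); (2, 1); (4, 4); (0, 2);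
  (4, 1); (1, 3); (3, 1); (1, 4); (3, 2)]).
Qed.

Lemma rn_upper_oo_all a b : 2 < a -> 2 < b -> odd a -> odd b ->
  2 * rn (grid a b) + 2 * wt_sum a b <= 2 * ((a + b - 2).+1 * (a * b).-1) + 2.
Proof.
pose U a b := 2 * rn (grid a b) + 2 * wt_sum a b <= 2 * ((a + b - 2).+1 * (a * b).-1) + 2.
rewrite -/(U a b).
have swap x y : 0 < x -> 0 < y -> U y x -> U x y.
  move=> x0 y0; rewrite /U /wt_sum (addnC (x * _)) (addnC y x) (mulnC y x).
  by have := rn_grid_swap x0 y0; lia.
have oddE n : odd n -> n = (2 * n./2).+1 by lia.
move=> a2 b2 /oddE Ea /oddE Eb.
have h1 : 0 < a./2 by lia. have k1 : 0 < b./2 by lia.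
rewrite Ea Eb.
(* A side of length at least 7 may be taken as the first one by symmetry; otherwise both sides are 3
   or 5 and a table applies. *)
case: (ltnP 2 a./2) => h3; first exact: rn_upper_oo.
case: (ltnP 2 b./2) => k3; first by apply: swap => //; apply: rn_upper_oo.
case: (a./2) (b./2) h1 h3 k1 k3 => [|[|[|?]]] [|[|[|?]]] // _ _ _ _.
- exact: rn_upper_33.
- by apply: swap => //; apply: rn_upper_53.
- exact: rn_upper_53.
exact: rn_upper_55.
Qed.

(** * From the doubled identity to the closed formulas *)

Lemma wt_sum_double a b :
  2 * wt_sum a b + odd a * b + odd b * a = a * a * b + b * b * a.
Proof.
have sq n : 2 * (n * n)./2 + odd n = n * n.
  by have := odd_double_half (n * n); rewrite oddM andbb; lia.
by rewrite -(sq a) -(sq b) /wt_sum; lia.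
Qed.

(** Every term is placed on the side where it is added, so that the identity can be cast to the
    rationals without truncated subtraction or halving. *)
Lemma rn_value a b c : 0 < a -> 0 < b ->
    2 * rn (grid a b) + 2 * wt_sum a b = 2 * ((a + b - 2).+1 * (a * b).-1) + 2 * c ->
  2 * rn (grid a b) + a * a * b + b * b * a + 2 * a + 2 * b + 2 * (a * b) =
  2 * (a * (a * b)) + 2 * (b * (a * b)) + 2 + 2 * c + odd a * b + odd b * a.
Proof.
move=> a0 b0; have W := wt_sum_double a b.
have [n nE] : exists n, a * b = n.+1.
  by exists (a * b).-1; rewrite prednK // muln_gt0 a0.
have [d dE] : exists d, a + b = d.+1 by exists (a + b).-1; lia.
have -> : (a + b - 2).+1 = d by lia.
have : a * (a * b) + b * (a * b) = d.+1 * n.+1 by rewrite -mulnDl dE nE.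
by rewrite nE /= mulSn !mulnS; lia.
Qed.

Local Open Scope ring_scope.

Theorem theorem5p1 (a b : nat) (ha : (2 < a)%N) (hb : (2 < b)%N) :
  let A : rat := a%:R in
  let B : rat := b%:R in
  let r : rat := (rn (grid a b))%:R in
  (~~ odd a -> ~~ odd b ->
     r = (A ^+ 2 * B + B ^+ 2 * A) / 2 - A * B - A - B + 6) /\
  (~~ odd a -> odd b ->
     r = (A ^+ 2 * B + B ^+ 2 * A - A) / 2 - A * B - B + 2) /\
  (odd a -> odd b ->
     r = (A ^+ 2 * B + B ^+ 2 * A - A - B) / 2 - A * B + 2).
Proof.
move=> A B r; have [a0 b0] : (0 < a)%N /\ (0 < b)%N by lia.
have value c : (2 * rn (grid a b) + 2 * wt_sum a b =
      2 * ((a + b - 2).+1 * (a * b).-1) + 2 * c)%N ->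
    2 * r + A * A * B + B * B * A + 2 * A + 2 * B + 2 * (A * B) =
    2 * (A * (A * B)) + 2 * (B * (A * B)) + 2 + 2 * c%:R + (odd a)%:R * B + (odd b)%:R * A.
  move=> E; have V := rn_value a0 b0 E; have := congr1 (fun n => n%:R : rat) V.
  by rewrite !GRing.natrD !GRing.natrM -/A -/B -/r; lra.
have [F0 T1] : (false : nat)%:R = 0 :> rat /\ (true : nat)%:R = 1 :> rat by [].
split=> [ea eb|]; last split=> [ea ob|oa ob].
- have Ea : a = (2 * a./2)%N by lia.
  have Eb : b = (2 * b./2)%N by lia.
  have h1 : (1 < a./2)%N by lia. have k1 : (1 < b./2)%N by lia.
  (* Here [c] is half of the 10 common to [rn_upper_ee] and [rn_lower_ee]; in the other cases it is
     half of 2. *)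
  have := value 5%N; rewrite (negbTE ea) (negbTE eb) F0 => V.
  suff /V : (2 * rn (grid a b) + 2 * wt_sum a b =
      2 * ((a + b - 2).+1 * (a * b).-1) + 2 * 5)%N by rewrite !GRing.expr2; lra.
  apply/eqP; rewrite eqn_leq Ea Eb.
  by rewrite (rn_upper_ee h1 k1) (rn_lower_ee h1 k1).
- have Ea : a = (2 * a./2)%N by lia.
  have Eb : b = (2 * b./2).+1%N by lia.
  have h1 : (1 < a./2)%N by lia. have k1 : (0 < b./2)%N by lia.
  have := value 1%N; rewrite (negbTE ea) ob F0 T1 => V.
  suff /V : (2 * rn (grid a b) + 2 * wt_sum a b =
      2 * ((a + b - 2).+1 * (a * b).-1) + 2 * 1)%N by rewrite !GRing.expr2; lra.
  apply/eqP; rewrite eqn_leq (rn_lower_eo a0 b0 ea ob) andbT.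
  by rewrite Ea Eb; apply: (rn_upper_eo h1 k1).
have := value 1%N; rewrite oa ob T1 => V.
suff /V : (2 * rn (grid a b) + 2 * wt_sum a b =
    2 * ((a + b - 2).+1 * (a * b).-1) + 2 * 1)%N by rewrite !GRing.expr2; lra.
apply/eqP; rewrite eqn_leq (rn_upper_oo_all ha hb oa ob).
by rewrite (rn_lower_oo _ b0 oa ob) //; lia.
Qed.
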